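(* Let $\mu:\mathbb{R}^d\to\mathbb{R}^d$, $\sigma:\mathbb{R}^d\to\mathbb{R}^{d\times d}$ be measurable and assume: (A1) $\mu$ is piecewise Lipschitz, and its exceptional set $\Theta$ is a $C^3$ hypersurface; (A2) there is $\varepsilon_0>0$ such that every $x$ with $d(x,\Theta)<\varepsilon_0$ has a unique closest point $p(x)\in\Theta$; (A3) there is $c_0>0$ with $\|\sigma(\xi)^\top n(\xi)\|\ge c_0$ for all $\xi\in\Theta$; (A4) there is $a$ such that every locally defined $\alpha$ is $C^3$ with all derivatives up to order 3 bounded by $a$. For $c\in(0,\varepsilon_0)$ let $G:\mathbb{R}^d\to\mathbb{R}^d$, $G(x)=x+\tilde\phi(x)\alpha(p(x))$ for $x\in\Theta^{\varepsilon_0}$ and $G(x)=x$ otherwise, where $\tilde\phi(x)=\big((x-p(x))\cdot n(p(x))\big)\|x-p(x)\|\phi(\|x-p(x)\|/c)$, $\phi(u)=(1+u)^3(1-u)^3$ for $|u|\le1$ and $\phi(u)=0$ otherwise. Then, if $c>0$ is sufficiently small, $G$ is a diffeomorphism $\mathbb{R}^d\to\mathbb{R}^d$.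
   Context: Length of a curve: $\ell(\gamma)=\sup\sum\|\gamma(t_k)-\gamma(t_{k-1})\|$ over partitions. Intrinsic metric on $A\subseteq\mathbb{R}^d$: $\rho(x,y)=\inf$ of lengths of continuous curves in $A$ from $x$ to $y$ ($\infty$ if none); $f$ is intrinsic Lipschitz on $A$ if $\|f(x)-f(y)\|\le L\rho(x,y)$. $f:\mathbb{R}^d\to\mathbb{R}^m$ is piecewise Lipschitz if for some hypersurface ($(d-1)$-dimensional submanifold) $\Theta$ with finitely many components $f|_{\mathbb{R}^d\setminus\Theta}$ is intrinsic Lipschitz ($\Theta$ = exceptional set). $\Theta^\varepsilon=\{x:d(x,\Theta)<\varepsilon\}$. On sufficiently small open connected $B\subseteq\Theta$ there is a $C^2$ unit normal field $n$ (unique up to sign); the locally defined function is $\alpha(\xi)=\lim_{h\to0+}\frac{\mu(\xi-hn(\xi))-\mu(\xi+hn(\xi))}{2n(\xi)^\top\sigma(\xi)\sigma(\xi)^\top n(\xi)}$, $\xi\in B$. The product $\tilde\phi(x)\alpha(p(x))$ does not depend on the sign choice of $n$, so $G$ is well defined. *)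

(* Defs.v *)
From HB Require Import structures.
From mathcomp Require Import all_boot all_order all_algebra.
From mathcomp Require Import all_classical all_reals all_analysis.
Set Implicit Arguments. Unset Strict Implicit. Unset Printing Implicit Defensive.
Import Order.TTheory GRing.Theory Num.Theory.
Import numFieldNormedType.Exports.
Local Open Scope classical_set_scope.
Local Open Scope ring_scope.

(* Euclidean inner product and Euclidean norm on R^n (the library norm on
   matrices is the sup norm; the paper uses the Euclidean norm). *)
Definition dotp {R : realType} {n : nat} (u v : 'rV[R]_n) : R :=
  \sum_(i < n) u 0 i * v 0 i.
Definition enorm {R : realType} {n : nat} (u : 'rV[R]_n) : R :=
  Num.sqrt (dotp u u).

Definition borel_measurable {T U : topologicalType} (f : T -> U) :=
  forall B : set U, open B -> <<s [set A : set T | open A] >> (f @^-1` B).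

Section Defs.
Context {R : realType} {d : nat}.
Local Notation V := 'rV[R]_d.

Definition ebasis (i : 'I_d) : V := delta_mx 0 i.

Definition pdiff {m : nat} (s : seq 'I_d) (F : V -> 'rV[R]_m) : V -> 'rV[R]_m :=
  foldr (fun i g => fun x => derive g x (ebasis i)) F s.

Definition Ck_on {m : nat} (k : nat) (U : set V) (F : V -> 'rV[R]_m) :=
  open U /\
  (forall s : seq 'I_d, (size s <= k)%N -> forall x, U x ->
      {for x, continuous (pdiff s F)}) /\
  (forall s : seq 'I_d, (size s < k)%N -> forall x, U x -> forall i,
      derivable (pdiff s F) x (ebasis i)).

(* Theta is a C^k hypersurface ((d-1)-dimensional embedded C^k submanifold):
   locally the zero set of a C^k real function with nonvanishing gradient
   (real functions are 1-dimensional row vectors). *)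
Definition hypersurface (k : nat) (Theta : set V) :=
  forall xi, Theta xi -> exists (U : set V) (f : V -> 'rV[R]_1),
    U xi /\ Ck_on k U f /\
    (forall x, U x -> exists i, pdiff [:: i] f x != 0) /\
    (forall x, U x -> (Theta x <-> f x = 0)).

Definition finitely_many_components (A : set V) :=
  finite_set [set connected_component A x | x in A].

Definition curve_length (gamma : R -> V) (a b : R) : \bar R :=
  ereal_sup [set l | exists (n : nat) (t : nat -> R),
     [/\ t 0%N = a, t n = b, (forall k, (k < n)%N -> t k <= t k.+1) &
         l = (\sum_(k < n) enorm (gamma (t k.+1) - gamma (t k)))%:E] ].

(* Intrinsic metric on A (+oo if no curve in A joins x to y). *)
Definition intrinsic_dist (A : set V) (x y : V) : \bar R :=
  ereal_inf [set l | exists (gamma : R -> V) (a b : R),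
     [/\ a <= b, {within [set t | a <= t <= b], continuous gamma},
         (forall t, a <= t <= b -> A (gamma t)),
         gamma a = x /\ gamma b = y & l = curve_length gamma a b] ].

Definition intrinsic_lipschitz {m : nat} (f : V -> 'rV[R]_m) (A : set V) :=
  exists L : R, forall x y, A x -> A y ->
    ((enorm (f x - f y))%:E <= L%:E * intrinsic_dist A x y)%E.

Definition piecewise_lipschitz_wrt {m : nat} (f : V -> 'rV[R]_m) (Theta : set V) :=
  [/\ hypersurface 1 Theta, finitely_many_components Theta &
      intrinsic_lipschitz f (~` Theta)].

(* Euclidean distance from x to a set (+oo for the empty set). *)
Definition dist_set (x : V) (A : set V) : \bar R :=
  ereal_inf [set (enorm (x - xi))%:E | xi in A].

Definition closest_point (A : set V) (x xi : V) :=
  A xi /\ (enorm (x - xi))%:E = dist_set x A.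

Definition tangent_vector (Theta : set V) (xi w : V) :=
  exists gamma : R -> V, [/\ gamma 0 = xi, \forall t \near 0, Theta (gamma t),
     derivable gamma 0 1 & derive gamma 0 1 = w].

Definition unit_normal (Theta : set V) (xi v : V) :=
  enorm v = 1 /\ forall w, tangent_vector Theta xi w -> dotp v w = 0.

Definition Ck_on_subset {m : nat} (k : nat) (S : set V) (g : V -> 'rV[R]_m) :=
  forall xi, S xi -> exists (U : set V) (F : V -> 'rV[R]_m),
    [/\ U xi, Ck_on k U F & forall x, U x -> S x -> F x = g x].

Definition Ck_bounded_on_subset {m : nat} (k : nat) (S : set V)
    (g : V -> 'rV[R]_m) (a : R) :=
  forall xi, S xi -> exists (U : set V) (F : V -> 'rV[R]_m),
    [/\ U xi, Ck_on k U F, forall x, U x -> S x -> F x = g x &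
        forall s : seq 'I_d, (size s <= k)%N -> forall x, U x -> S x ->
          enorm (pdiff s F x) <= a].

Definition local_normal_field (Theta B : set V) (n : V -> V) :=
  [/\ B `<=` Theta, (exists U : set V, open U /\ B = Theta `&` U), connected B,
      Ck_on_subset 2 B n & forall xi, B xi -> unit_normal Theta xi (n xi)].

Definition alpha_quot (mu : V -> V) (sigma : V -> 'M[R]_d) (xi v : V) (h : R) : V :=
  (2 * (v *m sigma xi *m (sigma xi)^T *m v^T) 0 0)^-1 *:
    (mu (xi - h *: v) - mu (xi + h *: v)).

Definition alpha_at (mu : V -> V) (sigma : V -> 'M[R]_d) (xi v : V) : V :=
  lim (alpha_quot mu sigma xi v h @[h --> 0^'+]).

Definition alpha_regular (mu : V -> V) (sigma : V -> 'M[R]_d) (Theta : set V) (a : R) :=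
  forall (B : set V) (n : V -> V), local_normal_field Theta B n ->
    (forall xi, B xi -> cvg (alpha_quot mu sigma xi (n xi) h @[h --> 0^'+])) /\
    Ck_bounded_on_subset 3 B (fun xi => alpha_at mu sigma xi (n xi)) a.

Definition phi (u : R) : R :=
  if `|u| <= 1 then (1 + u) ^+ 3 * (1 - u) ^+ 3 else 0.

Definition phitilde (p : V -> V) (c : R) (v x : V) : R :=
  dotp (x - p x) v * enorm (x - p x) * phi (enorm (x - p x) / c).

(* G is the map of the statement (for the parameters eps0, c and the
   closest-point map p); the value does not depend on the sign of v. *)
Definition G_spec (mu : V -> V) (sigma : V -> 'M[R]_d) (Theta : set V)
    (p : V -> V) (eps0 c : R) (G : V -> V) :=
  forall x,
    ((dist_set x Theta < eps0%:E)%E -> forall v, unit_normal Theta (p x) v ->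
        G x = x + phitilde p c v x *: alpha_at mu sigma (p x) v) /\
    (~ (dist_set x Theta < eps0%:E)%E -> G x = x).

Definition diffeomorphism (G : V -> V) :=
  exists H : V -> V, [/\ cancel G H, cancel H G, Ck_on 1 setT G & Ck_on 1 setT H].

End Defs.

(* Main.v *)
(** Moving away from Theta along [x - p x] stays on a ray with the same foot point until distance eps0
    (maximise the distance function on balls); hence Theta has positive reach, p is Lipschitz near Theta,
    and [x - p x = d(x) n(p x)].  Differentiating this relation and using that [Id + d Dn] is injective
    below the reach shows that p and the distance d are C^1 off Theta.  There [G x - x] equals
    [m(d(x)) F(p x)] with [m(s) = s^2 phi(s/c)] and F a local C^3 extension of alpha, so its Jacobian is
    at most a constant times [min(d(x), c)].  Therefore G is C^1, also across Theta where its Jacobian is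
    the identity, and for small c it is a Lipschitz-small perturbation of the identity, hence bijective with
    C^1 inverse. *)
Require Import Defs.
From HB Require Import structures.
From mathcomp Require Import all_boot all_order all_algebra.
From mathcomp Require Import all_classical all_reals all_analysis.
From mathcomp Require Import ring lra.
Set Implicit Arguments. Unset Strict Implicit. Unset Printing Implicit Defensive.
Import Order.TTheory GRing.Theory Num.Theory.
Import numFieldNormedType.Exports.
Local Open Scope classical_set_scope.
Local Open Scope ring_scope.

(** * Euclidean norm *)

(** The difficulty is uniformity: [Theta] may be unbounded and [n], [alpha] exist only locally, yet
    one threshold for [c] must serve everywhere. No curvature bound is assumed; the geometric
    estimates all come from [eps]. A point at distance at most [eps / 4] has its ray prolonged to
    distance [eps / 2], and [Theta] does not enter the open ball of that radius around the new end
    point. This slack by a factor 2 gives [p] the Lipschitz constant 2 and is what makes [Id + d Dn]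
    injective. With the bound [a] on F and DF at foot points, the Jacobian estimate then has a
    constant depending on [a] and the dimension only. The distance has a kink on [Theta], so the
    formula with [m(d)] and F is differentiated only off [Theta], with the local normal oriented
    towards the point considered. On [Theta] itself the derivative is read off from
    [|G x - x| <= |a| d(x)^2], which needs no regularity of p. No parametrization of [Theta] is
    used: points of [Theta] are found by the intermediate value theorem between points where a local
    equation has opposite signs. *)

Lemma continuous_distP {R : realType} {V W : normedModType R} (f : V -> W) x :
  {for x, continuous f} <->
  forall e, 0 < e -> \forall y \near x, `|f y - f x| <= e.
Proof.
split=> [/cvgrPdist_le fx e e0|fx]; first by apply: filterS (fx e e0) => y; rewrite distrC.
by apply/cvgrPdist_le => e e0; apply: filterS (fx e e0) => y; rewrite distrC.
Qed.

Ltac vec := apply/rowP => ?; rewrite !mxE; ring.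

Section EuclideanNorm.
Context {R : realType} {d : nat}.
Implicit Types (u v w : 'rV[R]_d) (k : R).

Lemma dotpC u v : dotp u v = dotp v u.
Proof. by apply: eq_bigr => i _; rewrite mulrC. Qed.

Lemma dotpDl u v w : dotp (u + v) w = dotp u w + dotp v w.
Proof. by rewrite -big_split; apply: eq_bigr => i _; rewrite mxE mulrDl. Qed.

Lemma dotpZl k u w : dotp (k *: u) w = k * dotp u w.
Proof. by rewrite /dotp mulr_sumr; apply: eq_bigr => i _; rewrite mxE mulrA. Qed.

Lemma dotpNl u w : dotp (- u) w = - dotp u w.
Proof. by rewrite -scaleN1r dotpZl mulN1r. Qed.

Lemma dotpDr u v w : dotp w (u + v) = dotp w u + dotp w v.
Proof. by rewrite !(dotpC w) dotpDl. Qed.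

Lemma dotpZr k u w : dotp w (k *: u) = k * dotp w u.
Proof. by rewrite !(dotpC w) dotpZl. Qed.

Lemma dotpNr u w : dotp w (- u) = - dotp w u.
Proof. by rewrite !(dotpC w) dotpNl. Qed.

Lemma dotp0r u : dotp u 0 = 0.
Proof. by rewrite -(scale0r 0) dotpZr mul0r. Qed.

Lemma dotp0l u : dotp 0 u = 0.
Proof. by rewrite dotpC dotp0r. Qed.

Definition dotpE := (dotpDl, dotpDr, dotpNl, dotpNr, dotpZl, dotpZr).

Lemma dotp_sqrD u v : dotp (u + v) (u + v) = dotp u u + 2 * dotp u v + dotp v v.
Proof. by rewrite !dotpE (dotpC v u); ring. Qed.

Lemma dotp_sqrB u v : dotp (u - v) (u - v) = dotp u u - 2 * dotp u v + dotp v v.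
Proof. by rewrite !dotpE (dotpC v u); ring. Qed.

Lemma dotp_ge0 u : 0 <= dotp u u.
Proof. by apply: sumr_ge0 => i _; rewrite -expr2 sqr_ge0. Qed.

Lemma enorm_ge0 u : 0 <= enorm u.
Proof. exact: sqrtr_ge0. Qed.

Lemma sqr_enorm u : enorm u ^+ 2 = dotp u u.
Proof. by rewrite sqr_sqrtr // dotp_ge0. Qed.

Lemma le_enorm u k : 0 <= k -> (enorm u <= k) = (dotp u u <= k ^+ 2).
Proof. by move=> k0; rewrite -sqr_enorm ler_sqr ?nnegrE ?enorm_ge0. Qed.

Lemma ge_enorm u k : 0 <= k -> (k <= enorm u) = (k ^+ 2 <= dotp u u).
Proof. by move=> k0; rewrite -sqr_enorm ler_sqr ?nnegrE ?enorm_ge0. Qed.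

Lemma enorm0 : enorm (0 : 'rV[R]_d) = 0.
Proof. by rewrite /enorm dotp0r sqrtr0. Qed.

Lemma enormN u : enorm (- u) = enorm u.
Proof. by rewrite /enorm !dotpE opprK. Qed.

Lemma enormB u v : enorm (u - v) = enorm (v - u).
Proof. by rewrite -enormN opprB. Qed.

Lemma enormZ k u : enorm (k *: u) = `|k| * enorm u.
Proof. by rewrite /enorm !dotpE mulrA -expr2 sqrtrM ?sqr_ge0// sqrtr_sqr. Qed.

Lemma mx_norm_le_enorm u : `|u| <= enorm u.
Proof.
rewrite /Num.norm /= mx_normrE.
apply: bigmax_le => [|[i j] _ /=]; first exact: enorm_ge0.
rewrite ord1 -sqrtr_sqr ler_sqrt ?dotp_ge0// /dotp (bigD1 j)//= -expr2 lerDl.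
by apply: sumr_ge0 => k _; rewrite -expr2 sqr_ge0.
Qed.

Lemma coord_le_norm m n (A : 'M[R]_(m, n)) i j : `|A i j| <= `|A|.
Proof.
rewrite {2}/Num.norm /= mx_normrE.
exact: (le_bigmax _ (fun ij => `|A ij.1 ij.2|) (i, j)).
Qed.

Lemma mx_norm_le m n (A : 'M[R]_(m, n)) k :
  0 <= k -> (forall i j, `|A i j| <= k) -> `|A| <= k.
Proof.
move=> k0 Ak; rewrite /Num.norm /= mx_normrE.
by apply: bigmax_le => // -[i j] _ /=.
Qed.

(** The factor [d] instead of its square root is harmless, since it is only absorbed into constants;
    the bound [d <= d ^ 2] covers dimension 0 as well. *)
Lemma enorm_le_mx_norm u : enorm u <= d%:R * `|u|.
Proof.
rewrite le_enorm ?mulr_ge0// /dotp.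
apply: (@le_trans _ _ (\sum_(i < d) `|u| ^+ 2)).
  apply: ler_sum => i _; rewrite -expr2 -real_normK ?num_real//.
  by rewrite lerXn2r ?nnegrE// coord_le_norm.
rewrite sumr_const card_ord -[leLHS]mulr_natl exprMn.
rewrite ler_wpM2r ?sqr_ge0// -natrX ler_nat.
by case: (d) => [|n]//; rewrite expnS expn1 leq_pmulr.
Qed.

Lemma enorm_eq0 u : enorm u = 0 -> u = 0.
Proof.
by move=> u0; apply/eqP; rewrite -normr_le0 -u0 mx_norm_le_enorm.
Qed.

Lemma dotp_eq0 u : dotp u u <= 0 -> u = 0.
Proof.
move=> u0; apply: enorm_eq0; apply/eqP; rewrite -sqrf_eq0 sqr_enorm.
by rewrite eq_le u0 dotp_ge0.
Qed.

Lemma cauchy_schwarz u v : dotp u v <= enorm u * enorm v.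
Proof.
have [u0|u0] := eqVneq (enorm u) 0; first by rewrite u0 (enorm_eq0 u0) dotp0l mul0r.
have [v0|v0] := eqVneq (enorm v) 0; first by rewrite v0 (enorm_eq0 v0) dotp0r mulr0.
have ep : 0 < enorm u * enorm v by rewrite mulr_gt0// lt_def ?u0 ?v0 enorm_ge0.
have := dotp_ge0 (enorm v *: u - enorm u *: v).
rewrite !dotpE -!sqr_enorm (dotpC v u); move: ep; move: (enorm u) (enorm v) => x y ep h.
by rewrite -(ler_pM2l ep); lra.
Qed.

Lemma norm_dotp u v : `|dotp u v| <= enorm u * enorm v.
Proof.
rewrite ler_norml cauchy_schwarz andbT lerNl -dotpNl.
by apply: le_trans (cauchy_schwarz _ _) _; rewrite enormN.
Qed.

Lemma enormD u v : enorm (u + v) <= enorm u + enorm v.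
Proof.
rewrite le_enorm ?addr_ge0 ?enorm_ge0// !dotpE (dotpC v u).
have := cauchy_schwarz u v; rewrite -!sqr_enorm; lra.
Qed.

Lemma enormD3 u v w : enorm (u - w) <= enorm (u - v) + enorm (v - w).
Proof. by apply: le_trans (enormD _ _); rewrite subrKA. Qed.

Lemma norm_dotp_sup u v : `|dotp u v| <= d%:R ^+ 2 * `|u| * `|v|.
Proof.
apply: le_trans (norm_dotp _ _) _.
have := ler_pM (enorm_ge0 u) (enorm_ge0 v) (enorm_le_mx_norm u) (enorm_le_mx_norm v).
by rewrite mulrACA -expr2 mulrA.
Qed.

Lemma near_enorm u k : 0 < k -> \forall v \near u, enorm (v - u) < k.
Proof.
move=> k0; have d1 : 0 < d%:R + 1 :> R by rewrite ltr_wpDl.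
apply/nbhs_normP; exists (k / (d%:R + 1)); first by rewrite /= divr_gt0.
move=> v /=; rewrite ltr_pdivlMr// distrC => uv.
apply: le_lt_trans (enorm_le_mx_norm _) (le_lt_trans _ uv).
by rewrite mulrC ler_wpM2l// lerDl.
Qed.

Lemma enorm_nbhs u (P : set 'rV[R]_d) k :
  0 < k -> (forall v, enorm (v - u) < k -> P v) -> \forall v \near u, P v.
Proof. by move=> k0 kP; apply: filterS (near_enorm u k0). Qed.

Lemma nbhs_enorm u (P : set 'rV[R]_d) :
  (\forall v \near u, P v) -> exists2 k, 0 < k & forall v, enorm (v - u) < k -> P v.
Proof.
move=> /nbhs_normP[k /= k0 kP]; exists k => // v vk; apply: kP => /=.
by rewrite distrC (le_lt_trans (mx_norm_le_enorm _)).
Qed.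

Lemma enormB_continuous (x : 'rV[R]_d) : continuous (fun y : 'rV[R]_d => enorm (y - x)).
Proof.
move=> y; apply/continuous_distP => e e0.
apply: (enorm_nbhs e0) => z /ltW zy.
have := enormD3 z y x; have := enormD3 y z x.
rewrite (enormB y z) ler_distl; lra.
Qed.

Lemma closed_enorm_le (x : 'rV[R]_d) (k : R) : closed [set y : 'rV[R]_d | enorm (y - x) <= k].
Proof.
apply: (@closed_comp _ _ (fun y : 'rV[R]_d => enorm (y - x)) [set t | t <= k]).
  by move=> y _; exact: enormB_continuous.
exact: closed_le.
Qed.

Lemma closed_enorm_ge (x : 'rV[R]_d) (k : R) : closed [set y : 'rV[R]_d | k <= enorm (y - x)].
Proof.
apply: (@closed_comp _ _ (fun y : 'rV[R]_d => enorm (y - x)) [set t | k <= t]).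
  by move=> y _; exact: enormB_continuous.
exact: closed_ge.
Qed.

Lemma bounded_enorm_le (x : 'rV[R]_d) (k : R) (A : set 'rV[R]_d) :
  (forall y, A y -> enorm (y - x) <= k) -> bounded_set A.
Proof.
move=> Ak; exists (`|x| + k); split; first exact: num_real.
move=> M kM y /Ak yk /=; rewrite -(subrK x y).
apply: le_trans (ler_normD _ _) (le_trans _ (ltW kM)).
by rewrite addrC lerD2l (le_trans (mx_norm_le_enorm _)).
Qed.

Lemma compact_enorm_le (x : 'rV[R]_d) (k : R) (A : set 'rV[R]_d) :
  closed A -> (forall y, A y -> enorm (y - x) <= k) -> compact A.
Proof. by move=> cA Ak; apply: bounded_closed_compact => //; exact: bounded_enorm_le Ak. Qed.

End EuclideanNorm.

Lemma continuous_enorm {R : realType} {d m : nat} (f : 'rV[R]_d -> 'rV[R]_m) x (e : R) : {for x, continuous f} -> 0 < e ->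
  exists2 r, 0 < r & forall y, enorm (y - x) < r -> enorm (f y - f x) < e.
Proof.
move=> /continuous_distP fx e0; apply: nbhs_enorm.
have m1 : 0 < m%:R + 1 :> R by rewrite ltr_wpDl.
apply: filterS (fx (e / (m%:R + 1) / 2) _) => [y h|]; last by rewrite !divr_gt0.
have := enorm_le_mx_norm (f y - f x).
have : (m%:R + 1) * `|f y - f x| <= (m%:R + 1) * (e / (m%:R + 1) / 2) by rewrite ler_pM2l.
have -> : (m%:R + 1) * (e / (m%:R + 1) / 2) = e / 2 by field; rewrite gt_eqF.
have := normr_ge0 (f y - f x); lra.
Qed.

(** * Sets with unique nearest points *)

(** The set where the distance to [Theta] is below [eps], written with a witness so that no extended
    real occurs; it is empty when [Theta] is. *)
Definition tube {R : realType} {d : nat} (Theta : set 'rV[R]_d) (eps : R) (x : 'rV[R]_d) :=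
  exists2 xi, Theta xi & enorm (x - xi) < eps.

Definition nearest_projection {R : realType} {d : nat} (Theta : set 'rV[R]_d) (eps : R)
    (p : 'rV[R]_d -> 'rV[R]_d) :=
  [/\ 0 < eps,
      forall x, tube Theta eps x -> Theta (p x),
      forall x xi, tube Theta eps x -> Theta xi -> enorm (x - p x) <= enorm (x - xi) &
      forall x xi, tube Theta eps x -> Theta xi -> enorm (x - xi) <= enorm (x - p x) ->
        xi = p x].

Section NearestPoint.
Context {R : realType} {d : nat}.
Local Notation V := 'rV[R]_d.
Context (Theta : set V) (eps : R) (p : V -> V).
Hypothesis proj : nearest_projection Theta eps p.
Local Notation T := (tube Theta eps).
Let delta (x : V) := enorm (x - p x).

Let eps_gt0 : 0 < eps. Proof. by case: proj. Qed.
Let p_in x : T x -> Theta (p x). Proof. by case: proj => _ + _ _; exact. Qed.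
Let p_min x xi : T x -> Theta xi -> delta x <= enorm (x - xi).
Proof. by case: proj => _ _ + _; exact. Qed.
Let p_uniq x xi : T x -> Theta xi -> enorm (x - xi) <= delta x -> xi = p x.
Proof. by case: proj => _ _ _; exact. Qed.

Lemma tube_dist_lt x : T x -> delta x < eps.
Proof. by move=> Tx; have [xi Txi] := Tx; apply: le_lt_trans; exact: p_min. Qed.

Lemma tube_ball x y : T x -> delta x + enorm (y - x) < eps -> T y.
Proof.
move=> Tx h; exists (p x); first exact: p_in.
by apply: le_lt_trans (enormD3 _ x _) _; rewrite addrC.
Qed.

Lemma tube_near x : T x -> \forall y \near x, T y.
Proof.
move=> Tx; have k0 : 0 < eps - delta x by rewrite subr_gt0 tube_dist_lt.
by apply: (enorm_nbhs k0) => y yk; apply: (tube_ball Tx); rewrite -ltrBrDl.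
Qed.

Lemma tube_dist_lip x y : T x -> T y -> delta y <= delta x + enorm (y - x).
Proof.
move=> Tx Ty; apply: le_trans (p_min Ty (p_in Tx)) _.
by apply: le_trans (enormD3 _ x _) _; rewrite addrC.
Qed.

Lemma sub_tube xi : Theta xi -> T xi.
Proof. by move=> Hxi; exists xi => //; rewrite subrr enorm0. Qed.

Lemma projection_id xi : Theta xi -> p xi = xi.
Proof.
by move=> Hxi; apply/esym/p_uniq => //; rewrite ?subrr ?enorm0 ?enorm_ge0//; exact: sub_tube.
Qed.

Lemma tube_dist0 x : T x -> delta x = 0 -> Theta x.
Proof.
move=> Tx /enorm_eq0/eqP; rewrite subr_eq0 => /eqP ->; exact: p_in.
Qed.

(** Closedness comes from the existence of closest points: a limit point of [Theta] lies in the
    tube, its distance to [Theta] is 0, and [p] attains it. *)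
Lemma projection_range_closed : closed Theta.
Proof.
move=> x clx.
have ap (e : R) : 0 < e -> exists2 xi, Theta xi & enorm (x - xi) < e.
  move=> e0; have [xi [Hxi xe]] := clx _ (near_enorm x e0).
  by exists xi => //; rewrite enormB.
have Tx : T x by exact: ap.
apply: tube_dist0 => //; apply/eqP; rewrite eq_le enorm_ge0 andbT.
rewrite leNgt; apply/negP => /ap[xi Hxi]; apply/negP; rewrite -leNgt; exact: p_min.
Qed.

(** Compactness and uniqueness: the points of [Theta] that stay away from [p x] are farther from [x]
    than [p x] by a fixed margin [eta], which a small move of [x] cannot make up. *)
Lemma projection_continuous x : T x -> {for x, continuous p}.
Proof.
move=> Tx; apply/continuous_distP => e e0.
pose K := [set xi | Theta xi /\ enorm (xi - x) <= delta x + 1] `&` [set xi | e <= enorm (xi - p x)].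
have cK : compact K.
  apply: (@compact_enorm_le _ _ x (delta x + 1)) => [|y [[]]//].
  apply: closedI; last exact: closed_enorm_ge.
  by apply: closedI; [exact: projection_range_closed|exact: closed_enorm_le].
have [eta eta0 Heta] : exists2 eta : R, 0 < eta & forall xi, K xi -> delta x + eta <= enorm (x - xi).
  have [K0|K0] := pselect (K !=set0); last first.
    by exists 1 => // xi Kxi; case: K0; exists xi.
  have [|xi1] := compact_EVT_min K0 cK (f := fun xi : V => enorm (xi - x)).
    by apply: continuous_subspaceT => xi; exact: enormB_continuous.
  rewrite inE => Kxi1 mn; exists (enorm (xi1 - x) - delta x).
    rewrite subr_gt0 enormB ltNge; apply/negP => /(p_uniq Tx Kxi1.1.1) xi1E.
    by have := Kxi1.2; rewrite /= xi1E subrr enorm0 leNgt e0.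
  by move=> xi Kxi; rewrite subrKC (enormB x) mn// inE.
(* Moving [x] by [h] changes [enorm (x - p y)] to at most [delta x + 2 h]: [2^-1] keeps [p y] in the
   ball defining [K], and [eta / 2] contradicts the margin. *)
have k0 : 0 < Num.min (2^-1) (eta / 2) by rewrite lt_min invr_gt0 ltr0n divr_gt0.
near=> y.
have yx : enorm (y - x) < Num.min (2^-1) (eta / 2) by near: y; exact: near_enorm.
have Ty : T y by near: y; exact: tube_near.
apply: le_trans (mx_norm_le_enorm _) _; rewrite leNgt; apply/negP => pye.
have h1 := tube_dist_lip Tx Ty; have h2 := enormD3 x y (p y).
move: yx; rewrite lt_min => /andP[yx1 yx2].
rewrite enormB in h2.
have : K (p y).
  split; last exact: ltW.
  split; first exact: p_in.
  move: h1 h2; rewrite -/(delta y) (enormB x y); lra.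
move=> /Heta; rewrite (enormB (p y)) in h2; move: h1 h2; rewrite -/(delta y) (enormB x y); lra.
Unshelve. all: by end_near. Qed.

(** By continuity of [p] the new foot point stays within [(1 - k) * delta y / 2] of [p y], so the
    vector from it to [y] still has almost all of [delta y] as its component along the ray. Squaring
    both sides gives the rate [k]. *)
Lemma dist_growth y (k : R) : T y -> 0 < delta y -> 0 < k < 1 ->
  exists2 r : R, 0 < r & forall h : R, 0 < h <= r ->
    delta y + k * h <= delta (y + h *: ((delta y)^-1 *: (y - p y))).
Proof.
move=> Ty dy /andP[k0 k1]; set nu := _ *: (y - p y).
have nuE : nu = (delta y)^-1 *: (y - p y) by [].
clearbody nu.
have nu1 : enorm nu = 1.
  by rewrite nuE enormZ ger0_norm ?invr_ge0 ?enorm_ge0// mulVf ?gt_eqF.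
have e0 : 0 < (1 - k) * delta y / 2 by rewrite divr_gt0 ?mulr_gt0// subr_gt0.
have [r1 r10 Hr1] := continuous_enorm (projection_continuous Ty) e0.
have [r2 r20 Hr2] := nbhs_enorm (tube_near Ty).
exists (Num.min (Num.min (r1 / 2) (r2 / 2)) ((1 - k) * delta y)).
  by rewrite !lt_min !divr_gt0// mulr_gt0// subr_gt0.
move=> h /andP[h0]; rewrite !le_min => /andP[/andP[h1 h2] h3].
have yh : enorm (y + h *: nu - y) = h.
  by rewrite addrC addKr enormZ nu1 mulr1 gtr0_norm.
have Tz : T (y + h *: nu) by apply: Hr2; rewrite yh; lra.
have := Hr1 (y + h *: nu); rewrite yh => /(_ ltac:(lra)).
set eta := p (y + h *: nu) => Heta.
have zE : y + h *: nu - eta = (y - eta) + h *: nu by rewrite addrAC.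
rewrite /delta -/eta ge_enorm ?addr_ge0 ?mulr_ge0 ?enorm_ge0 ?(ltW k0) ?(ltW h0)//.
rewrite zE dotp_sqrD !dotpZr !dotpZl -(sqr_enorm nu) nu1.
have yeE : dotp (y - eta) nu = delta y - dotp (eta - p y) nu.
  have {1}-> : y - eta = (y - p y) - (eta - p y) by vec.
  rewrite (dotpDl (y - p y)) dotpNl; congr (_ - _).
  by rewrite nuE dotpZr -sqr_enorm expr2 mulKf// gt_eqF.
have := cauchy_schwarz (eta - p y) nu; rewrite nu1 mulr1.
have : delta y ^+ 2 <= dotp (y - eta) (y - eta).
  by rewrite -sqr_enorm ler_sqr ?nnegrE ?enorm_ge0// p_min//; exact: p_in.
rewrite yeE -/(delta y); move: (dotp (y - eta) _) (dotp (eta - p y) nu) => A B.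
move: (enorm _) Heta dy h0 h3 k0 k1 => E; move: (delta y) => D.
move=> ED D0 h0 h3 k0 k1 DA BE.
have hk : h * B <= h * ((1 - k) * D / 2) by rewrite ler_pM2l//; lra.
have : 0 <= h * (D * (1 - k)) by rewrite !mulr_ge0//; lra.
have : (k * h) ^+ 2 <= h ^+ 2 by rewrite ler_sqr ?nnegrE ?mulr_ge0 ?ler_piMl//; lra.
lra.
Qed.

(* A maximiser of [delta - k |. - x|] on the ball lies on its boundary since [delta] grows
   at unit rate along [y - p y]; letting [k] tend to 1, the maximum of [delta] is attained at distance [r]. *)
Lemma dist_extension x (r : R) : T x -> 0 < delta x -> 0 < r -> delta x + r < eps ->
  exists2 y, enorm (y - x) <= r & T y /\ delta x + r <= delta y.
Proof.
move=> Tx dx r0 xr.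
pose A := [set y | enorm (y - x) <= r].
have AT y : A y -> T y.
  by move=> Ay; apply: (tube_ball Tx); apply: le_lt_trans xr; rewrite lerD2l.
have cA : compact A by apply: (@compact_enorm_le _ _ x r) => //; exact: closed_enorm_le.
have A0 : A !=set0 by exists x; rewrite /A /= subrr enorm0 ltW.
have dcont y : A y -> {for y, continuous delta}.
  move=> /AT Ty; apply/continuous_distP => e e0.
  have := tube_near Ty; apply: filterS2 (near_enorm y e0) => z zy Tz.
  have := tube_dist_lip Ty Tz; have := tube_dist_lip Tz Ty.
  rewrite (enormB y z) ler_distl; lra.
have step (k : R) : 0 < k < 1 -> exists2 y, A y & delta x + k * r <= delta y.
  move=> k01; have /andP[k0 k1] := k01.
  have [|y] := compact_EVT_max A0 cA (f := fun y => delta y - k * enorm (y - x)).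
    apply: continuous_in_subspaceT => y; rewrite inE => Ay.
    apply: continuousB; first exact: dcont.
    by apply: continuousM; [exact: cst_continuous|exact: enormB_continuous].
  rewrite inE => Ay ymax; exists y => //.
  have xA : A x by rewrite /A /= subrr enorm0 ltW.
  have := ymax x (mem_set xA); rewrite subrr enorm0 mulr0 subr0 => xy.
  suff -> : r = enorm (y - x) by lra.
  apply/eqP; rewrite eq_le Ay andbT leNgt; apply/negP => yr.
  have dy : 0 < delta y.
    by apply: lt_le_trans dx (le_trans xy _); rewrite gerBl mulr_ge0 ?enorm_ge0// ltW.
  (* A growth rate strictly between [k] and 1 beats the penalty [k * enorm (y - x)], so an interior
     maximiser could be improved inside the ball. *)
  have k'01 : 0 < (1 + k) / 2 < 1 by lra.
  have [s s0 Hs] := dist_growth (AT _ Ay) dy k'01.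
  have h0 : 0 < Num.min s (r - enorm (y - x)) by rewrite lt_min s0 subr_gt0.
  move: h0; set h := Num.min _ _ => h0.
  have hs : h <= s by rewrite /h ge_min lexx.
  have hr : h <= r - enorm (y - x) by rewrite /h ge_min lexx orbT.
  have := Hs h; rewrite h0 hs => /(_ isT).
  set z := y + _ => zd.
  have zy : enorm (z - y) = h.
    rewrite /z addrC addKr !enormZ gtr0_norm// ger0_norm ?invr_ge0 ?enorm_ge0//.
    by rewrite mulVf ?mulr1 ?gt_eqF.
  have zx := enormD3 z y x; rewrite zy in zx.
  have zA : A z by rewrite /A /=; lra.
  have := ymax z (mem_set zA).
  have : k * enorm (z - x) <= k * (h + enorm (y - x)) by rewrite ler_pM2l.
  have : 0 < h * (1 - k) by rewrite mulr_gt0// subr_gt0.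
  lra.
have [|y] := compact_EVT_max A0 cA (f := delta).
  by apply: continuous_in_subspaceT => y; rewrite inE => /dcont.
rewrite inE => Ay ymax; exists y => //; split; first exact: AT.
apply/ler_addgt0Pl => e e0.
(* With this [k] the growth [k * r] falls short of [r] by at most [e]; [2^-1] only keeps [k]
   positive. *)
have k0 : 0 < Num.max (1 - e / r) (2^-1) < 1.
  by rewrite lt_max gt_max invr_gt0 ltr0n orbT/= invf_lt1 ?ltr1n// ltrBlDr ltrDl divr_gt0.
have [z Az zd] := step _ k0.
have : delta z <= delta y by apply: ymax; rewrite inE.
have : (1 - e / r) * r <= Num.max (1 - e / r) (2^-1) * r by rewrite ler_pM2r// le_max lexx.
rewrite mulrBl divfK ?gt_eqF//; lra.
Qed.

(** The point given by [dist_extension] is at distance at most [t] from [p x] and at least [t] from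
    [Theta], so [p x] is its closest point. *)
Lemma normal_ray x t : T x -> 0 < delta x -> delta x <= t < eps ->
  exists y, [/\ T y, p y = p x & y - p x = (t / delta x) *: (x - p x)].
Proof.
move=> Tx dx /andP[]; rewrite le_eqVlt => /predU1P[<- _|xt te].
  by exists x; split=> //; rewrite divff ?scale1r// gt_eqF.
have r0 : 0 < t - delta x by rewrite subr_gt0.
have [|y yx [Ty dy]] := dist_extension Tx dx r0; first by rewrite subrKC.
rewrite subrKC in dy.
have yp : enorm (y - p x) <= t.
  by apply: le_trans (enormD3 _ x _) _; rewrite -/(delta x); lra.
have pyx : p x = p y by apply: (p_uniq Ty (p_in Tx)); exact: le_trans dy.
exists y; split=> //.
(* Equality case of the triangle inequality through [x]: it forces [y] onto the ray, which is shown
   by the squared distance to the ray point being at most 0. *)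
apply/eqP; rewrite -subr_eq0; apply/eqP/dotp_eq0.
have : dotp (y - x) (y - x) <= (t - delta x) ^+ 2 by rewrite -le_enorm// ltW.
have : dotp (y - p x) (y - p x) = t ^+ 2.
  by rewrite -sqr_enorm; congr (_ ^+ 2); apply/eqP; rewrite eq_le yp {1}pyx dy.
have -> : y - x = (y - p x) - (x - p x) by vec.
rewrite (dotp_sqrB _ (x - p x)) (dotp_sqrB _ (_ *: _)) !dotpZr !dotpZl -(sqr_enorm (x - p x)) -/(delta x).
move: (dotp (y - p x) (y - p x)) (dotp (y - p x) (x - p x)) => A B -> h.
have dne : delta x != 0 by rewrite gt_eqF.
have -> : t / delta x * (t / delta x * delta x ^+ 2) = t ^+ 2 by field.
have tB : delta x * t <= B by nra.
have : (t / delta x) * (delta x * t) <= t / delta x * B by rewrite ler_pM2l// divr_gt0//; lra.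
have -> : (t / delta x) * (delta x * t) = t ^+ 2 by field.
move: (t / delta x * B) => Z; lra.
Qed.

(** Federer's inequality for sets of positive reach: expand [enorm (y - p x) <= enorm (y - eta)] for
    the point [y] of the ray at distance [t] from [p x]. *)
Lemma prox_regular x t eta : T x -> Theta eta -> delta x <= t < eps ->
  2 * t * dotp (x - p x) (eta - p x) <= delta x * enorm (eta - p x) ^+ 2.
Proof.
move=> Tx He te; have := enorm_ge0 (x - p x); rewrite -/(delta x) le_eqVlt => /predU1P[d0|dx].
  by rewrite (enorm_eq0 (esym d0)) dotp0l mulr0 -d0 mul0r.
have [y [Ty pyx yE]] := normal_ray Tx dx te.
have := p_min Ty He; rewrite /delta pyx => h0.
have {h0} : enorm (y - p x) ^+ 2 <= enorm (y - eta) ^+ 2.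
  by rewrite ler_sqr ?nnegrE ?enorm_ge0.
have -> : y - eta = (y - p x) - (eta - p x) by vec.
rewrite !sqr_enorm (dotp_sqrB _ (eta - p x)) yE !dotpZl !dotpZr.
set A := _ * (_ * dotp (x - p x) (x - p x)).
move: (dotp (x - p x) (eta - p x)) (dotp (eta - p x) (eta - p x)) => B C h.
have : 2 * (t / delta x) * B <= C by clearbody A; lra.
rewrite -(ler_pM2l dx) => /(le_trans _); apply.
by rewrite le_eqVlt; apply/orP; left; apply/eqP; field; rewrite gt_eqF.
Qed.

(** Apply [prox_regular] with [t = eps / 2] at both points. Since both distances are at most
    [eps / 4], each inner product is at most a quarter of [w ^ 2], where [w = enorm (p x - p y)];
    thus [w ^ 2 / 2 <= enorm (x - y) * w]. *)
Lemma projection_lip x y : T x -> T y -> delta x <= eps / 4 -> delta y <= eps / 4 ->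
  enorm (p x - p y) <= 2 * enorm (x - y).
Proof.
move=> Tx Ty dx dy.
have te z : delta z <= eps / 4 -> delta z <= eps / 2 < eps.
  by move=> ?; apply/andP; split; move: eps_gt0; lra.
have hx := prox_regular Tx (p_in Ty) (te _ dx).
have hy := prox_regular Ty (p_in Tx) (te _ dy).
have : dotp (x - y) (p x - p y) <= enorm (x - y) * enorm (p x - p y) by exact: cauchy_schwarz.
have -> : dotp (x - y) (p x - p y) =
    enorm (p x - p y) ^+ 2 - dotp (x - p x) (p y - p x) - dotp (y - p y) (p x - p y).
  have {1}-> : x - y = (x - p x) - (y - p y) + (p x - p y) by vec.
  have -> : p y - p x = - (p x - p y) by vec.
  by rewrite sqr_enorm !dotpE; ring.
rewrite enormB in hx; have := enorm_ge0 (p x - p y); rewrite le_eqVlt => /predU1P[<- _|w0].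
  by rewrite mulr_ge0 ?enorm_ge0.
move: (dotp _ _) (dotp _ _) hx hy => A B; move: (enorm (p x - p y)) w0 => w w0 hx hy h.
have w2 : 0 < w ^+ 2 by rewrite exprn_gt0.
have h1 : delta x * w ^+ 2 <= eps / 4 * w ^+ 2 by rewrite ler_pM2r.
have h2 : delta y * w ^+ 2 <= eps / 4 * w ^+ 2 by rewrite ler_pM2r.
have h3 : A + B <= w ^+ 2 / 2.
  rewrite -(ler_pM2l eps_gt0); lra.
rewrite -(ler_pM2r w0); lra.
Qed.
End NearestPoint.

(** * Differentiability and C^k maps *)

Section TotalDerivative.
Context {R : realType}.

(** Frechet derivative with the little-o spelled out. Linearity and boundedness of [L] are not built
    in; lemmas that rely on them ask for them explicitly. *)
Definition tder {V W : normedModType R} (f : V -> W) (x : V) (L : V -> W) :=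
  forall e : R, 0 < e -> \forall y \near x, `|f y - f x - L (y - x)| <= e * `|y - x|.

(** Dividing by [k + 1] rather than [k] spares the case [k = 0] in all error budgets. *)
Lemma ler_div1p (e k : R) : 0 <= e -> 0 <= k -> e / (k + 1) * k <= e.
Proof.
move=> e0 k0; rewrite -mulrA ler_piMr// mulrC ler_pdivrMr ?ltr_wpDl//.
by rewrite mul1r lerDl.
Qed.

Context {U V W : normedModType R}.
Implicit Types (f : U -> V) (x : U).

Lemma near_norm_le x (e : R) : 0 < e -> \forall y \near x, `|y - x| <= e.
Proof.
by move=> e0; apply/nbhs_normP; exists e => // y /=; rewrite distrC => /ltW.
Qed.

Lemma tder_near_lip f x L (K : R) : tder f x L -> (forall u, `|L u| <= K * `|u|) ->
  \forall y \near x, `|f y - f x| <= (K + 1) * `|y - x|.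
Proof.
move=> fL LK; apply: filterS (fL 1 ltr01) => y h.
rewrite -(subrK (L (y - x)) (f y - f x)) (le_trans (ler_normD _ _))//.
by rewrite mulrDl addrC lerD.
Qed.

Lemma near_lip_continuous f x (K : R) : 0 <= K ->
  (\forall y \near x, `|f y - f x| <= K * `|y - x|) -> {for x, continuous f}.
Proof.
move=> K0 fK; apply/continuous_distP => e e0.
have K1 : 0 < K + 1 by rewrite ltr_wpDl.
have e1 : 0 < e / (K + 1) by rewrite divr_gt0.
near=> y; have yx : `|y - x| <= e / (K + 1).
  by near: y; exact: near_norm_le.
apply: (@le_trans _ _ (K * `|y - x|)); first by near: y.
apply: (@le_trans _ _ ((K + 1) * `|y - x|)); first by rewrite ler_wpM2r// lerDl.
by rewrite mulrC -ler_pdivlMr.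
Unshelve. all: by end_near. Qed.

Lemma tder_continuous f x L (K : R) : 0 <= K -> tder f x L -> (forall u, `|L u| <= K * `|u|) ->
  {for x, continuous f}.
Proof.
move=> K0 fL LK; apply: (@near_lip_continuous f x (K + 1)); first by rewrite addr_ge0.
exact: tder_near_lip fL LK.
Qed.

Lemma tder_near_eq f g x L : (\forall y \near x, f y = g y) -> tder f x L -> tder g x L.
Proof.
move=> fg fL e e0; have fgx := nbhs_singleton fg.
by apply: filterS2 fg (fL e e0) => y <-; rewrite fgx.
Qed.

Lemma tder_eq f x L M : (forall u, L u = M u) -> tder f x L -> tder f x M.
Proof. by move=> LM fL e e0; apply: filterS (fL e e0) => y; rewrite LM. Qed.

Lemma tder_quadratic f x L (K : R) : 0 <= K ->
  (\forall y \near x, `|f y - f x - L (y - x)| <= K * `|y - x| ^+ 2) -> tder f x L.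
Proof.
move=> K0 fK e e0; have K1 : 0 < K + 1 by rewrite ltr_wpDl.
have e1 : 0 < e / (K + 1) by rewrite divr_gt0.
near=> y; have yx : `|y - x| <= e / (K + 1).
  by near: y; exact: near_norm_le.
apply: (@le_trans _ _ (K * `|y - x| ^+ 2)); first by near: y.
rewrite expr2 mulrA ler_wpM2r// (@le_trans _ _ ((K + 1) * `|y - x|))//.
  by rewrite ler_wpM2r// lerDl.
by rewrite mulrC -ler_pdivlMr.
Unshelve. all: by end_near. Qed.

Lemma tder_comp f (g : V -> W) x L M (K K' : R) : 0 <= K -> 0 <= K' ->
  tder f x L -> tder g (f x) M ->
  (forall u, `|L u| <= K * `|u|) -> (forall u, `|M u| <= K' * `|u|) ->
  (forall u v, M (u + v) = M u + M v) -> tder (g \o f) x (M \o L).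
Proof.
move=> K0 K'0 fL gM LK MK MD e e0.
have e1 : 0 < e / 2 / (K + 1) by rewrite !divr_gt0// ltr_wpDl.
have e2 : 0 < e / 2 / (K' + 1) by rewrite !divr_gt0// ltr_wpDl.
have cf := tder_continuous K0 fL LK.
near=> y.
have h1 : `|g (f y) - g (f x) - M (f y - f x)| <= e / 2 / (K + 1) * `|f y - f x|.
  near: y; exact: (cf _ (gM _ e1)).
have h2 : `|f y - f x| <= (K + 1) * `|y - x| by near: y; exact: tder_near_lip fL LK.
have h3 : `|f y - f x - L (y - x)| <= e / 2 / (K' + 1) * `|y - x| by near: y; exact: fL.
have ME : M (f y - f x) = M (f y - f x - L (y - x)) + M (L (y - x)) by rewrite -MD subrK.
have -> : (g \o f) y - (g \o f) x - (M \o L) (y - x) =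
    g (f y) - g (f x) - M (f y - f x) + M (f y - f x - L (y - x)).
  by rewrite ME /= opprD addrA addrAC subrK.
apply: le_trans (ler_normD _ _) _; rewrite [e in leRHS]splitr mulrDl lerD//.
  apply: le_trans h1 _; apply: le_trans (ler_wpM2l (ltW e1) h2) _.
  by rewrite mulrA divfK// gt_eqF// ltr_wpDl.
apply: le_trans (MK _) _; apply: le_trans (ler_wpM2l K'0 h3) _.
by rewrite mulrA ler_wpM2r// mulrC ler_div1p// divr_ge0// ltW.
Unshelve. all: by end_near. Qed.

Lemma tder_is_derive f x L v : tder f x L -> (forall (h : R) u, L (h *: u) = h *: L u) ->
  is_derive x v f (L v).
Proof.
move=> fL Lh.
have key : h^-1 *: ((f \o shift x) (h *: v) - f x) @[h --> 0^'] --> L v.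
  apply/cvgrPdist_le => e e0.
  have v1 : 0 < `|v| + 1 by rewrite ltr_wpDl.
  have e1 : 0 < e / (`|v| + 1) by rewrite divr_gt0.
  have /nbhs_normP[r /= r0 Hr] := fL _ e1.
  near=> h.
  have h0 : h != 0 by near: h; exact: nbhs_dnbhs_neq.
  have hr : `|h| < r / (`|v| + 1) by near: h; apply: dnbhs0_lt; rewrite divr_gt0.
  have hv : `|h *: v| < r.
    rewrite normrZ; apply: le_lt_trans (_ : `|h| * (`|v| + 1) < r).
      by rewrite ler_wpM2l// lerDl.
    by rewrite -ltr_pdivlMr.
  have := Hr (h *: v + x); rewrite /ball_ /= opprD addrCA addrN addr0 normrN addrK => /(_ hv) h1.
  have -> : L v - h^-1 *: ((f \o shift x) (h *: v) - f x) =
      - (h^-1 *: (f (h *: v + x) - f x - L (h *: v))).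
    by rewrite Lh [in RHS]scalerBr scalerA mulVf// scale1r opprB.
  rewrite normrN normrZ normfV ler_pdivrMl ?normr_gt0//.
  by apply: le_trans h1 _; rewrite normrZ mulrCA ler_wpM2l// ler_div1p// ltW.
by apply: DeriveDef; [apply/cvg_ex; exists (L v)|exact/cvg_lim].
Unshelve. all: by end_near. Qed.

(** A local Lipschitz constant bounds the derivative: compare the increment along a short multiple
    of [u] with its linear part and rescale by homogeneity. With [K = 0] this shows that a
    derivative vanishes. *)
Lemma tder_lip_bound f x L (K : R) : tder f x L -> (forall (h : R) u, L (h *: u) = h *: L u) ->
  (\forall y \near x, `|f y - f x| <= K * `|y - x|) -> forall u, `|L u| <= K * `|u|.
Proof.
move=> fL Lh fK u; have [->|u0] := eqVneq u 0.
  have -> : L 0 = 0 by rewrite -[X in L X](scale0r 0) Lh scale0r.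
  by rewrite !normr0 mulr0.
apply/ler_addgt0Pr => e e0; have un : 0 < `|u| by rewrite normr_gt0.
have e1 : 0 < e / `|u| by rewrite divr_gt0.
have /nbhs_normP[r /= r0 Hr] : \forall y \near x,
    `|f y - f x - L (y - x)| <= e / `|u| * `|y - x| /\ `|f y - f x| <= K * `|y - x|.
  by apply: filterS2 (fL _ e1) fK => y.
have h0 : 0 < r / 2 / `|u| by rewrite !divr_gt0.
have := Hr (r / 2 / `|u| *: u + x); rewrite /ball_ /= opprD addrCA addrN addr0 normrN addrK normrZ gtr0_norm//.
rewrite divfK ?gt_eqF// ltr_pdivrMr// ltr_pMr// ltr1n => /(_ isT)[h1 h2].
rewrite Lh in h1; set s := r / 2 / `|u| in h0 h1 h2 *.
have r2 : r / 2 = s * `|u| by rewrite divfK// gt_eqF.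
have : s * `|L u| <= s * (K * `|u| + e).
  rewrite -[s in leLHS]gtr0_norm// -normrZ -normrN.
  have -> : - (s *: L u) = (f (s *: u + x) - f x - s *: L u) - (f (s *: u + x) - f x).
    by rewrite addrAC subrr sub0r.
  apply: le_trans (ler_normB _ _) _; apply: le_trans (lerD h1 h2) _.
  rewrite r2 mulrCA divfK ?gt_eqF//; lra.
by rewrite ler_pM2l.
Qed.

Lemma derivable_tder (f : R -> V) (t : R) : derivable f t 1 ->
  tder f t (fun u => u *: 'D_1 f t).
Proof.
move=> df e e0.
have /cvgrPdist_le/(_ e e0)/nbhs_normP[r /= r0 Hr] := df.
apply/nbhs_normP; exists r => // y /=; rewrite distrC => yr.
have [->|yt] := eqVneq y t; first by rewrite !subrr scale0r subrr !normr0 mulr0.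
have h0 : y - t != 0 by rewrite subr_eq0.
have := Hr (y - t); rewrite /ball_ /= sub0r normrN => /(_ yr h0).
rewrite [(y - t) *: 1]mulr1 subrK => h1.
have -> : f y - f t - (y - t) *: 'D_1 f t =
    - ((y - t) *: ('D_1 f t - (y - t)^-1 *: (f y - f t))).
  by rewrite scalerBr scalerA divff// scale1r opprB.
by rewrite normrN normrZ mulrC ler_wpM2r.
Qed.

Lemma line_is_derive f (z w : U) (t : R) : derivable f (z + t *: w) w ->
  is_derive t 1 (fun s => f (z + s *: w)) ('D_w f (z + t *: w)).
Proof.
move=> df.
have key : h^-1 *: (((fun s => f (z + s *: w)) \o shift t) (h *: 1) - f (z + t *: w)) @[h --> 0^']
    --> 'D_w f (z + t *: w).
  have -> : (fun h : R => h^-1 *: (((fun s => f (z + s *: w)) \o shift t) (h *: 1) - f (z + t *: w)))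
      = (fun h => h^-1 *: ((f \o shift (z + t *: w)) (h *: w) - f (z + t *: w))).
    by apply/funext => h /=; rewrite [h *: 1]mulr1 scalerDl addrCA.
  exact: df.
by apply: DeriveDef; [apply/cvg_ex; eexists; exact: key|exact/cvg_lim].
Qed.

End TotalDerivative.

Section TotalDerivativeMatrix.
Context {R : realType}.

Lemma tder_scale {U : normedModType R} {m} (a : U -> R) (f : U -> 'rV[R]_m) x (A : U -> R) L
    (K K' : R) : 0 <= K -> 0 <= K' ->
  tder a x A -> tder f x L ->
  (forall u, `|A u| <= K * `|u|) -> (forall u, `|L u| <= K' * `|u|) ->
  tder (fun y => a y *: f y) x (fun u => A u *: f x + a x *: L u).
Proof.
move=> K0 K'0 aA fL AK LK e e0.
have e1 : 0 < e / 3 / (`|f x| + 1) by rewrite !divr_gt0// ltr_wpDl.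
have e2 : 0 < e / 3 / (`|a x| + 1) by rewrite !divr_gt0// ltr_wpDl.
have KK : 0 < (K + 1) * (K' + 1) by rewrite mulr_gt0// ltr_wpDl.
have e3 : 0 < e / 3 / ((K + 1) * (K' + 1)) by rewrite !divr_gt0// ltr_wpDl.
near=> y.
have h1 : `|a y - a x - A (y - x)| <= e / 3 / (`|f x| + 1) * `|y - x| by near: y; exact: aA.
have h2 : `|f y - f x - L (y - x)| <= e / 3 / (`|a x| + 1) * `|y - x| by near: y; exact: fL.
have h3 : `|a y - a x| <= (K + 1) * `|y - x| by near: y; exact: tder_near_lip aA AK.
have h4 : `|f y - f x| <= (K' + 1) * `|y - x| by near: y; exact: tder_near_lip fL LK.
have h5 : `|y - x| <= e / 3 / ((K + 1) * (K' + 1)) by near: y; exact: near_norm_le.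
(* Two first-order remainders with the other factor frozen at [x], plus a product of two increments,
   which is quadratic in [y - x]; each gets a third of [e]. *)
have -> : a y *: f y - a x *: f x - (A (y - x) *: f x + a x *: L (y - x)) =
    (a y - a x - A (y - x)) *: f x + a x *: (f y - f x - L (y - x)) + (a y - a x) *: (f y - f x).
  by vec.
have -> : e = e / 3 + e / 3 + e / 3 by field.
rewrite !mulrDl; apply: le_trans (ler_normD _ _) (lerD _ _); first apply: le_trans (ler_normD _ _) (lerD _ _).
- rewrite normrZ; apply: le_trans (ler_wpM2r (normr_ge0 _) h1) _.
  by rewrite mulrAC ler_wpM2r// ler_div1p// divr_ge0// ltW.
- rewrite normrZ mulrC; apply: le_trans (ler_wpM2r (normr_ge0 _) h2) _.
  by rewrite mulrAC ler_wpM2r// ler_div1p// divr_ge0// ltW.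
- rewrite normrZ; apply: le_trans (ler_pM (normr_ge0 _) (normr_ge0 _) h3 h4) _.
  rewrite mulrACA mulrA ler_wpM2r// mulrC.
  by rewrite -ler_pdivlMr.
Unshelve. all: by end_near. Qed.

Lemma norm_mulmx m n k (A : 'M[R]_(m, n)) (B : 'M[R]_(n, k)) :
  `|A *m B| <= n%:R * (`|A| * `|B|).
Proof.
apply: mx_norm_le => [|i j]; first by rewrite !mulr_ge0.
rewrite mxE; apply: le_trans (ler_norm_sum _ _ _) _.
apply: (@le_trans _ _ (\sum_(l < n) (`|A| * `|B|))).
  by apply: ler_sum => l _; rewrite normrM ler_pM// coord_le_norm.
by rewrite sumr_const card_ord mulr_natl.
Qed.

Lemma continuous_mx {U : normedModType R} {m n} (A : U -> 'M[R]_(m, n)) x :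
  (forall i j, {for x, continuous (fun y => A y i j)}) -> {for x, continuous A}.
Proof.
move=> Aij; apply/continuous_distP => e e0.
have : \forall y \near x, forall ij : 'I_m * 'I_n, `|A y ij.1 ij.2 - A x ij.1 ij.2| <= e.
  by apply: filter_forall => -[i j] /=; exact: ((continuous_distP _ _).1 (Aij i j) _ e0).
apply: filterS => y Ay; apply: mx_norm_le => [|i j]; first exact: ltW.
by rewrite !mxE; exact: (Ay (i, j)).
Qed.

Lemma continuous_coord {U : normedModType R} {m n} (A : U -> 'M[R]_(m, n)) x i j :
  {for x, continuous A} -> {for x, continuous (fun y => A y i j)}.
Proof.
move=> /continuous_distP cA; apply/continuous_distP => e e0.
apply: filterS (cA e e0) => y; apply: le_trans.
by have := coord_le_norm (A y - A x) i j; rewrite !mxE.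
Qed.

Lemma eq_continuous_for {U V : normedModType R} (f g : U -> V) x :
  f =1 g -> {for x, continuous f} -> {for x, continuous g}.
Proof. by move=> /funext ->. Qed.

Lemma continuous_sum {U : normedModType R} {I : finType} (F : I -> U -> R) x :
  (forall i, {for x, continuous (F i)}) -> {for x, continuous (fun y => \sum_i F i y)}.
Proof.
move=> cF; rewrite unlock /=; elim: (index_enum I) => [|i s IH] /=; first exact: cst_continuous.
by apply: continuousD; [exact: cF|exact: IH].
Qed.

Lemma continuous_mulmx {U : normedModType R} {m n k} (A : U -> 'M[R]_(m, n))
    (B : U -> 'M[R]_(n, k)) x :
  {for x, continuous A} -> {for x, continuous B} -> {for x, continuous (fun y => A y *m B y)}.
Proof.
move=> cA cB; apply: continuous_mx => i j.
apply: (@eq_continuous_for _ _ (fun y => \sum_l A y i l * B y l j)) => [y|]; first by rewrite mxE.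
apply: continuous_sum => l.
by apply: continuousM; exact: continuous_coord.
Qed.

End TotalDerivativeMatrix.

(** * Jacobian matrices, and total differentiability from continuous partial derivatives *)

Section Jacobian.
Context {R : realType} {d : nat}.
Local Notation V := 'rV[R]_d.

(** Rows are indexed by the direction, so that the derivative acts on row vectors from the right as
    [u *m jac F x]. *)
Definition jac {m} (F : V -> 'rV[R]_m) (x : V) : 'M[R]_(d, m) :=
  \matrix_(i, j) derive F x (ebasis i) 0 j.

Lemma norm_ebasis i : `|@ebasis R d i| <= 1.
Proof.
apply: mx_norm_le => // k j; rewrite mxE.
by case: (_ && _); rewrite ?normr1 ?normr0.
Qed.

Lemma tder_jac {m} (F : V -> 'rV[R]_m) x (J : 'M[R]_(d, m)) :
  tder F x (fun u => u *m J) -> jac F x = J.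
Proof.
move=> FJ; apply/matrixP => i j; rewrite mxE.
have h : is_derive x (ebasis i) F (ebasis i *m J).
  by apply: tder_is_derive FJ _ => k u; rewrite scalemxAl.
by rewrite derive_val -rowE mxE.
Qed.

(** The broken line from [x] to [y] that changes one coordinate at a time. *)
Lemma telescope_path (x y : V) (k : 'I_d) :
  (\row_i (if (i < k.+1)%N then y 0 i else x 0 i) : V) =
  (\row_i (if (i < k)%N then y 0 i else x 0 i) : V) + (y 0 k - x 0 k) *: ebasis k.
Proof.
apply/rowP => i; rewrite !mxE ltnS leq_eqVlt.
have [->|ik] := eqVneq i k; first by rewrite !eqxx ltnn /= mulr1 subrKC.
have -> : (i == k :> nat) = false by apply/negbTE.
by rewrite eqxx /= mulr0 addr0.
Qed.

Lemma axis_mvt (f : V -> R) (z : V) i (s : R) :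
  (forall t, `|t| <= `|s| -> derivable f (z + t *: ebasis i) (ebasis i)) ->
  exists2 t, `|t| <= `|s| &
    f (z + s *: ebasis i) - f z = s * derive f (z + t *: ebasis i) (ebasis i).
Proof.
move=> df; pose g t := f (z + t *: ebasis i).
pose g' (t : R) := 'D_(ebasis i) f (z + t *: ebasis i).
have dg (t : R) : `|t| <= `|s| -> is_derive t 1 g (g' t).
  by move=> ts; apply: line_is_derive; exact: df.
have g0 : f z = g 0 by rewrite /g scale0r addr0.
have cg (a b : R) : (forall t, a <= t <= b -> `|t| <= `|s|) -> {within `[a, b], continuous g}.
  move=> ab; apply: derivable_within_continuous => t; rewrite in_itv /= => /ab/dg h.
  exact: ex_derive.
have [s0|s0] := leP 0 s.
  have b t : 0 <= t <= s -> `|t| <= `|s| by move=> /andP[t0 ts]; rewrite !ger0_norm.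
  have [||t] := @MVT_segment _ g g' 0 s s0.
  - by move=> t; rewrite in_itv /= => /andP[t0 t1]; apply: dg; rewrite b// !ltW.
  - exact: cg.
  rewrite in_itv /= => /b tb h; exists t => //; rewrite g0 -/(g s) h subr0 mulrC//.
have b t : s <= t <= 0 -> `|t| <= `|s|.
  by move=> /andP[t0 ts]; rewrite ler0_norm// ltr0_norm// lerN2.
have [||t] := @MVT_segment _ g g' s 0 (ltW s0).
- by move=> t; rewrite in_itv /= => /andP[t0 t1]; apply: dg; rewrite b// !ltW.
- exact: cg.
rewrite in_itv /= => /b tb h; exists t => //; rewrite g0 -/(g s) -opprB h sub0r mulrN opprK mulrC//.
Qed.

Lemma Ck_on_le {m} (k l : nat) (U : set V) (F : V -> 'rV[R]_m) :
  (k <= l)%N -> Ck_on l U F -> Ck_on k U F.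
Proof.
move=> kl [oU [cF dF]]; split=> //; split=> s sk; [apply: cF|apply: dF].
  exact: leq_trans kl.
exact: leq_trans kl.
Qed.

Lemma Ck_on_jac_continuous {m} (U : set V) (F : V -> 'rV[R]_m) x :
  Ck_on 1 U F -> U x -> {for x, continuous (jac F)}.
Proof.
move=> [oU [cF _]] Ux; apply: continuous_mx => i j.
apply: (@eq_continuous_for _ _ _ (fun y => pdiff [:: i] F y 0 j)) => [y|]; first by rewrite mxE.
by apply: continuous_coord; exact: cF.
Qed.

(** The increment is telescoped along the axis-parallel broken line from [x] to [y]; the mean value
    theorem turns each piece into a partial derivative at a nearby point, and continuity of the
    partials compares it with its value at [x]. *)
Lemma Ck_on_tder {m} (U : set V) (F : V -> 'rV[R]_m) x :
  Ck_on 1 U F -> U x -> tder F x (fun u => u *m jac F x).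
Proof.
move=> C1F Ux e e0; have cJ := Ck_on_jac_continuous C1F Ux.
have [oU [_ dF]] := C1F.
have e1 : 0 < e / (d%:R + 1) by rewrite divr_gt0// ltr_wpDl.
have Unear : \forall y \near x, U y by exact: open_nbhs_nbhs.
have /nbhs_normP[r /= r0 Hr] : \forall y \near x, U y /\ `|jac F y - jac F x| <= e / (d%:R + 1).
  by apply: filterS2 Unear ((continuous_distP _ _).1 cJ _ e1) => y.
apply/nbhs_normP; exists r => // y /=; rewrite distrC => yr.
apply: mx_norm_le => [|i j]; first by rewrite mulr_ge0// ltW.
rewrite ord1 {i}.
pose v k : V := \row_i (if (i < k)%N then y 0 i else x 0 i).
have v0 : v 0%N = x by apply/rowP => i; rewrite mxE.
have vd : v d = y by apply/rowP => i; rewrite mxE ltn_ord.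
have uk k : `|y 0 k - x 0 k| <= `|y - x|.
  by have := coord_le_norm (y - x) 0 k; rewrite !mxE.
have vball (k : 'I_d) t : `|t| <= `|y 0 k - x 0 k| -> `|v k + t *: ebasis k - x| < r.
  move=> tk; apply: le_lt_trans yr; apply: mx_norm_le => // i j'; rewrite ord1 !mxE.
  have [->|j'k] := eqVneq j' k.
    by rewrite ltnn /= mulr1 addrAC subrr add0r (le_trans tk).
  rewrite andbF mulr0 addr0; case: ifP => _; last by rewrite subrr normr0.
  exact: uk.
have step (k : 'I_d) : `|F (v k.+1) 0 j - F (v k) 0 j - (y 0 k - x 0 k) * jac F x k j| <=
    e / (d%:R + 1) * `|y - x|.
  rewrite /v telescope_path -/(v k).
  have [|t tk ->] := @axis_mvt (fun z => F z 0 j) (v k) k (y 0 k - x 0 k).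
    move=> t /vball h; move: (0 : 'I_1) j; apply/derivable_mxP; apply: (dF [::]) => //.
    by apply: (Hr _ _).1; rewrite /= distrC.
  have [Uz Jz] := Hr (v k + t *: ebasis k) (ltac:(by rewrite /= distrC; exact: vball)).
  rewrite -mulrBr normrM mulrC ler_pM//.
  have -> : derive (fun z => F z 0 j) (v k + t *: ebasis k) (ebasis k) = jac F (v k + t *: ebasis k) k j.
    by rewrite mxE derive_mx ?mxE//; exact: (dF [::]).
  by apply: le_trans Jz; have := coord_le_norm (jac F (v k + t *: ebasis k) - jac F x) k j; rewrite !mxE.
have -> : (F y - F x - (y - x) *m jac F x) 0 j =
    \sum_(k < d) (F (v k.+1) 0 j - F (v k) 0 j - (y 0 k - x 0 k) * jac F x k j).
  rewrite sumrB !mxE; congr (_ - _).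
    rewrite -(big_mkord xpredT (fun k => F (v k.+1) 0 j - F (v k) 0 j)).
    by rewrite (telescope_sumr (fun k => F (v k) 0 j))// vd v0.
  by apply: eq_bigr => k _; rewrite !mxE.
apply: le_trans (ler_norm_sum _ _ _) _.
apply: le_trans (ler_sum _ (fun k _ => step k)) _.
rewrite sumr_const card_ord -mulrnAl ler_wpM2r// -mulr_natr ler_div1p// ltW//.
Qed.

End Jacobian.

(** * C^1 regularity at a point, an implicit differentiation lemma and the mean value inequality *)

Section PointwiseC1.
Context {R : realType} {d : nat}.
Local Notation V := 'rV[R]_d.

(** A pointwise notion, so that the points off and on [Theta] can be treated by different arguments
    and assembled by [C1at_Ck_on]. *)
Definition C1at {m} (F : V -> 'rV[R]_m) (x0 : V) :=
  (\forall x \near x0, tder F x (fun u => u *m jac F x)) /\ {for x0, continuous (jac F)}.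

Lemma continuous_near_eq {U W : normedModType R} (f g : U -> W) x :
  (\forall y \near x, f y = g y) -> {for x, continuous f} -> {for x, continuous g}.
Proof.
move=> fg /continuous_distP cf; apply/continuous_distP => e e0.
by rewrite -(nbhs_singleton fg); apply: filterS2 fg (cf e e0) => y ->.
Qed.

Lemma C1at_intro {m} (F : V -> 'rV[R]_m) x0 (J : V -> 'M[R]_(d, m)) :
  (\forall x \near x0, tder F x (fun u => u *m J x)) -> {for x0, continuous J} -> C1at F x0.
Proof.
move=> FJ cJ; split; first by apply: filterS FJ => x h; rewrite (tder_jac h).
by apply: (continuous_near_eq _ cJ); apply: filterS FJ => x h; rewrite (tder_jac h).
Qed.

Lemma norm_mulmx_rV {m} (J : 'M[R]_(d, m)) (u : V) : `|u *m J| <= d%:R * `|J| * `|u|.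
Proof. by rewrite -mulrA [`|J| * _]mulrC norm_mulmx. Qed.

Lemma C1at_continuous {m} (F : V -> 'rV[R]_m) x : C1at F x -> {for x, continuous F}.
Proof.
move=> [/nbhs_singleton FJ _].
by apply: (tder_continuous _ FJ (norm_mulmx_rV _)); rewrite mulr_ge0.
Qed.

Lemma tder_mul_derive {m} (F : V -> 'rV[R]_m) x (J : 'M[R]_(d, m)) i :
  tder F x (fun u => u *m J) -> is_derive x (ebasis i) F (ebasis i *m J).
Proof. by move=> h; apply: tder_is_derive h _ => k u; rewrite scalemxAl. Qed.

Lemma C1at_Ck_on {m} (F : V -> 'rV[R]_m) : (forall x, C1at F x) -> Ck_on 1 setT F.
Proof.
move=> CF; split; first exact: openT.
split=> [[|i [|//]] _ x _ | [|//] _ x _ i] /=.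
- exact: C1at_continuous.
- apply: (@eq_continuous_for _ _ _ (fun y => ebasis i *m jac F y)) => [y|].
    have [/nbhs_singleton h _] := CF y.
    by have hd := tder_mul_derive i h; rewrite derive_val.
  by apply: continuous_mulmx; [exact: cst_continuous|exact: (CF x).2].
- have [/nbhs_singleton h _] := CF x.
  by have hd := tder_mul_derive i h; exact: ex_derive.
Qed.

Lemma unitmx_inj (A : 'M[R]_d) : (forall v : V, v *m A = 0 -> v = 0) -> A \in unitmx.
Proof.
move=> inj; rewrite -row_free_unit -kermx_eq0; apply/eqP/row_matrixP => i.
by rewrite row0; apply: inj; rewrite -row_mul mulmx_ker row0.
Qed.

Lemma norm_entry_le {m} (J : 'M[R]_(d, m)) (K : R) : 0 <= K ->
  (forall u : V, `|u *m J| <= K * `|u|) -> `|J| <= K.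
Proof.
move=> K0 JK; apply: mx_norm_le => // i j.
have := coord_le_norm (@ebasis R d i *m J) 0 j; rewrite -rowE mxE => /le_trans; apply.
by rewrite rowE (le_trans (JK _))// ler_piMr// norm_ebasis.
Qed.

(* If [q] is Lipschitz and [(q y - q x) M x = (y - x) N x + o(y - x)] with [M x] invertible, then [q] has
   Jacobian [N x (M x)^-1]; its continuity follows from [J M = N] and the Lipschitz bound on [J]. *)
Lemma implicit_C1at (q : V -> V) (M N : V -> 'M[R]_d) x0 (K : R) : 0 <= K ->
  (\forall x \near x0, \forall y \near x, `|q y - q x| <= K * `|y - x|) ->
  {for x0, continuous M} -> {for x0, continuous N} ->
  (\forall x \near x0, M x \in unitmx) ->
  (\forall x \near x0, forall e : R, 0 < e -> \forall y \near x,
     `|(q y - q x) *m M x - (y - x) *m N x| <= e * `|y - x|) ->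
  C1at q x0 /\ (\forall x \near x0, `|jac q x| <= K).
Proof.
move=> K0 qlip cM cN uM qMN.
have tJ : \forall x \near x0, tder q x (fun u => u *m (N x *m invmx (M x))).
  apply: filterS2 uM qMN => x Mx qx e e0.
  have e1 : 0 < e / (d%:R * `|invmx (M x)| + 1) by rewrite divr_gt0// ltr_wpDl ?mulr_ge0.
  apply: filterS (qx _ e1) => y h.
  have -> : q y - q x - (y - x) *m (N x *m invmx (M x)) =
      ((q y - q x) *m M x - (y - x) *m N x) *m invmx (M x).
    by rewrite [RHS]mulmxBl (mulmxK Mx) mulmxA.
  apply: le_trans (norm_mulmx_rV _ _) _.
  apply: le_trans (ler_wpM2l _ h) _; first by rewrite mulr_ge0.
  by rewrite mulrA ler_wpM2r// mulrC ler_div1p ?mulr_ge0// ltW.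
have bJ : \forall x \near x0, `|N x *m invmx (M x)| <= K.
  apply: filterS2 tJ qlip => x h lx; apply: norm_entry_le => // u.
  by apply: (tder_lip_bound h) => // k v; rewrite scalemxAl.
split; last by apply: filterS2 tJ bJ => x /tder_jac ->.
apply: (C1at_intro tJ); apply/continuous_distP => e e0.
pose J x := N x *m invmx (M x).
pose B := d%:R * `|invmx (M x0)| * (1 + d%:R * K) + 1.
have B0 : 0 < B by rewrite ltr_wpDl// !mulr_ge0// addr_ge0// mulr_ge0.
have e1 : 0 < e / B by rewrite divr_gt0.
have uM0 := nbhs_singleton uM.
have cMN : \forall x \near x0, `|M x - M x0| <= e / B /\ `|N x - N x0| <= e / B.
  by apply: filterS2 ((continuous_distP _ _).1 cM _ e1) ((continuous_distP _ _).1 cN _ e1) => x.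
have ubJ : \forall x \near x0, M x \in unitmx /\ `|J x| <= K by apply: filterS2 uM bJ => x.
apply: filterS2 cMN ubJ => x [hM hN] [ux bx].
have JM : J x *m M x = N x by rewrite mulmxKV.
(* Only the inverse at [x0] remains on the right, so continuity of matrix inversion is bypassed; the
   factor [J x] is bounded by [K]. *)
have -> : N x *m invmx (M x) - N x0 *m invmx (M x0) =
    ((N x - N x0) - J x *m (M x - M x0)) *m invmx (M x0).
  have -> : (N x - N x0) - J x *m (M x - M x0) = J x *m M x0 - N x0.
    rewrite mulmxBr JM; move: (J x *m M x0) => A.
    by apply/matrixP => k l; rewrite !mxE; ring.
  by rewrite mulmxBl (mulmxK uM0).
apply: le_trans (norm_mulmx _ _) _.
have h : `|N x - N x0 - J x *m (M x - M x0)| <= e / B * (1 + d%:R * K).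
  apply: le_trans (ler_normB _ _) _; rewrite mulrDr mulr1 lerD//.
  apply: le_trans (norm_mulmx _ _) _; rewrite [leRHS]mulrCA ler_wpM2l// mulrC.
  by rewrite ler_pM.
apply: le_trans (ler_wpM2l _ (ler_wpM2r _ h)) _ => //.
have -> : d%:R * (e / B * (1 + d%:R * K) * `|invmx (M x0)|) = e / B * (B - 1).
  by rewrite /B; ring.
apply: (@le_trans _ _ (e / B * B)); last by rewrite divfK// gt_eqF.
by rewrite ler_pM2l// gerBl.
Qed.

Lemma coord_tder {U : normedModType R} {m} (F : U -> 'rV[R]_m) x L j :
  tder F x L -> tder (fun y => F y 0 j) x (fun u => L u 0 j).
Proof.
move=> FL e e0; apply: filterS (FL e e0) => y; apply: le_trans.
by have := coord_le_norm (F y - F x - L (y - x)) 0 j; rewrite !mxE.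
Qed.

(** The sup norm allows the scalar mean value theorem coordinate by coordinate, with a different
    intermediate point for each, at no cost in the constant. *)
Lemma mean_value_ineq {m} (F : V -> 'rV[R]_m) (J : V -> 'M[R]_(d, m)) (K : R) : 0 <= K ->
  (forall x, tder F x (fun u => u *m J x)) -> (forall x (u : V), `|u *m J x| <= K * `|u|) ->
  forall x y, `|F y - F x| <= K * `|y - x|.
Proof.
move=> K0 FJ JK x y; apply: mx_norm_le => [|i j]; first by rewrite mulr_ge0.
rewrite ord1 {i} !mxE; set w := y - x.
pose g (t : R) := F (x + t *: w) 0 j.
pose g' (t : R) := (w *m J (x + t *: w)) 0 j.
have dg (t : R) : is_derive t 1 g (g' t).
  have h : is_derive (x + t *: w) w (fun z => F z 0 j) (g' t).
    apply: (tder_is_derive _ (coord_tder j (FJ _))) => k u.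
    by rewrite -scalemxAl mxE.
  have [h1 h2] := h; rewrite -h2.
  exact: (@line_is_derive _ _ _ (fun z => F z 0 j)).
have [|t _] := @MVT_segment _ g g' 0 1 ler01.
  by apply: derivable_within_continuous => t _; have := dg t => h; exact: ex_derive.
rewrite /g scale1r scale0r addr0 subr0 mulr1 /w subrKC => ->.
by apply: le_trans (coord_le_norm _ _ _) _; exact: JK.
Qed.

End PointwiseC1.

(** * Closure properties of C^k real functions *)

Section SmoothFunctions.
Context {R : realType} {d : nat}.
Local Notation V := 'rV[R]_d.

(** Turns a directional derivative into a one-variable one, to which the chain rule for the square
    root applies. *)
Lemma is_derive_lineP {W : normedModType R} (f : V -> W) x w D :
  is_derive x w f D <-> is_derive (0 : R) 1 (fun s : R => f (x + s *: w)) D.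
Proof.
have E : (fun h : R => h^-1 *: (((fun s => f (x + s *: w)) \o shift (0 : R)) (h *: 1) - f (x + (0 : R) *: w)))
    = (fun h => h^-1 *: ((f \o shift x) (h *: w) - f x)).
  by apply/funext => h /=; rewrite [h *: 1]mulr1 addr0 scale0r addr0 (addrC x).
by split=> -[dfx fD]; apply: DeriveDef; move: dfx fD; rewrite /derivable /derive E.
Qed.

Lemma is_derive_sqrt_comp (q : V -> R) x v dq : 0 < q x -> is_derive x v q dq ->
  is_derive x v (fun y => Num.sqrt (q y)) ((2 * Num.sqrt (q x))^-1 * dq).
Proof.
move=> qx /is_derive_lineP hq; apply/is_derive_lineP.
apply: (@is_derive1_comp _ Num.sqrt (fun s => q (x + s *: v))) => //.
by rewrite scale0r addr0; exact: is_derive1_sqrt.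
Qed.

(** C^k for real functions by recursion on [k], with the partial derivatives given as witnesses;
    sums, products and inverse square roots then follow by induction, which is awkward with the
    iterated [pdiff]. *)
Fixpoint smooth_on (k : nat) (U : set V) (h : V -> R) : Prop :=
  (forall x, U x -> {for x, continuous h}) /\
  if k is k'.+1 then forall i, exists h' : V -> R,
    (forall x, U x -> is_derive x (ebasis i) h (h' x)) /\ smooth_on k' U h' else True.

Lemma smooth_on_continuous k U h : smooth_on k U h -> forall x, U x -> {for x, continuous h}.
Proof. by case: k => [|k] []. Qed.

Lemma smooth_on_pred k U h : smooth_on k.+1 U h -> smooth_on k U h.
Proof.
elim: k h => [|k IH] h [ch dh]; split=> // i.
by have [h' [dh' sh']] := dh i; exists h'; split=> //; exact: IH.
Qed.

Lemma smooth_on_cst k U (c : R) : smooth_on k U (fun=> c).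
Proof.
elim: k c => [|k IH] c; split=> //; try by move=> x _; exact: cst_continuous.
by move=> i; exists (fun=> 0); split=> // x _; exact: is_derive_cst.
Qed.

Lemma smooth_onD k U f g : smooth_on k U f -> smooth_on k U g -> smooth_on k U (fun x => f x + g x).
Proof.
elim: k f g => [|k IH] f g [cf df] [cg dg]; split=> //.
- by move=> x Ux; apply: continuousD; [exact: cf|exact: cg].
- by move=> x Ux; apply: continuousD; [exact: cf|exact: cg].
move=> i; have [f' [ff' sf']] := df i; have [g' [gg' sg']] := dg i.
exists (fun x => f' x + g' x); split; last exact: IH.
by move=> x Ux; apply: is_deriveD; [exact: ff'|exact: gg'].
Qed.

Lemma smooth_onM k U f g : smooth_on k U f -> smooth_on k U g -> smooth_on k U (fun x => f x * g x).
Proof.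
elim: k f g => [|k IH] f g sf sg; have [cf df] := sf; have [cg dg] := sg; split=> //.
- by move=> x Ux; apply: continuousM; [exact: cf|exact: cg].
- by move=> x Ux; apply: continuousM; [exact: cf|exact: cg].
move=> i; have [f' [ff' sf']] := df i; have [g' [gg' sg']] := dg i.
exists (fun x => f x * g' x + g x * f' x); split.
  by move=> x Ux; apply: is_deriveM; [exact: ff'|exact: gg'].
by apply: smooth_onD; apply: IH => //; exact: smooth_on_pred.
Qed.

Lemma smooth_on_sum k U {I : finType} (F : I -> V -> R) : (forall i, smooth_on k U (F i)) ->
  smooth_on k U (fun x => \sum_i F i x).
Proof.
move=> sF; rewrite unlock /=; elim: (index_enum I) => [|i s IH] /=; first exact: smooth_on_cst.
exact: smooth_onD.
Qed.

(** For [r] the inverse square root of [q], the derivative is [- r ^ 3 q' / 2], a product of [r] and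
    [q']; hence the induction on [k] closes. *)
Lemma smooth_on_rsqrt k U q : smooth_on k U q -> (forall x, U x -> 0 < q x) ->
  smooth_on k U (fun x => (Num.sqrt (q x))^-1).
Proof.
move=> + q0.
have cr x : U x -> {for x, continuous q} -> {for x, continuous (fun x => (Num.sqrt (q x))^-1)}.
  move=> Ux cq; apply: continuousV; first by rewrite gt_eqF// sqrtr_gt0 q0.
  by apply: continuous_comp => //; exact: sqrt_continuous.
elim: k => [|k IH] sq; have [cq dq] := sq; split=> //; try by move=> x Ux; apply: cr => //; exact: cq.
move=> i; have [q' [qq' sq']] := dq i.
have sr := IH (smooth_on_pred sq).
pose r x := (Num.sqrt (q x))^-1.
exists (fun x => r x * (r x * (r x * (- (2^-1) * q' x)))); split; last first.
  by do !apply: smooth_onM => //; exact: smooth_on_cst.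
move=> x Ux; have qx := q0 x Ux; have sx : Num.sqrt (q x) != 0 by rewrite gt_eqF// sqrtr_gt0.
have [h1 h2] := is_derive_sqrt_comp qx (qq' x Ux).
apply: DeriveDef; first exact: derivableV.
rewrite deriveV// h2 /r -[_ *: _]/(_ * _); field.
by rewrite sx.
Qed.

Lemma smooth_on_near_eq k U f g : open U -> (forall x, U x -> f x = g x) ->
  smooth_on k U f -> smooth_on k U g.
Proof.
move=> oU fg; have near_fg x : U x -> \forall y \near x, f y = g y.
  by move=> Ux; apply: filterS fg _; exact: open_nbhs_nbhs.
case: k => [|k] [cf df]; split=> //; try by move=> x Ux; apply: continuous_near_eq (near_fg x Ux) (cf x Ux).
move=> i; have [f' [ff' sf']] := df i; exists f'; split=> // x Ux.
by apply: near_eq_is_derive (ff' x Ux); exact: near_fg.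
Qed.

Lemma pdiff_rcons {m} (F : V -> 'rV[R]_m) (s : seq 'I_d) i :
  pdiff (rcons s i) F = pdiff s (pdiff [:: i] F).
Proof. by rewrite /pdiff foldr_rcons. Qed.

Lemma derivable_coord_is_derive {m} (F : V -> 'rV[R]_m) x v j : derivable F x v ->
  is_derive x v (fun y => F y 0 j) (derive F x v 0 j).
Proof.
move=> dF; apply: DeriveDef; last by rewrite derive_mx// mxE.
by move: (0 : 'I_1) j; apply/derivable_mxP.
Qed.

Lemma Ck_on_pdiff {m} k U (F : V -> 'rV[R]_m) i : Ck_on k.+1 U F -> Ck_on k U (pdiff [:: i] F).
Proof.
move=> [oU [cF dF]]; split=> //; split=> s sk; rewrite -pdiff_rcons; [apply: cF|apply: dF];
  by rewrite size_rcons.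
Qed.

Lemma Ck_on_smooth {m} k U (F : V -> 'rV[R]_m) j : Ck_on k U F -> smooth_on k U (fun x => F x 0 j).
Proof.
elim: k F => [|k IH] F [oU [cF dF]]; split=> //.
- by move=> x Ux; apply: continuous_coord; exact: (cF [::]).
- by move=> x Ux; apply: continuous_coord; exact: (cF [::]).
move=> i; exists (fun x => pdiff [:: i] F x 0 j); split.
  by move=> x Ux; apply: derivable_coord_is_derive; exact: (dF [::]).
by apply: IH; exact: Ck_on_pdiff.
Qed.

Lemma smooth_Ck_on {m} k U (F : V -> 'rV[R]_m) : open U ->
  (forall j, smooth_on k U (fun x => F x 0 j)) -> Ck_on k U F.
Proof.
move=> oU sF; split=> //.
have cF (G : V -> 'rV[R]_m) l x : (forall j, smooth_on l U (fun x => G x 0 j)) -> U x -> {for x, continuous G}.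
  move=> sG Ux; apply: continuous_mx => i j; rewrite ord1.
  exact: smooth_on_continuous (sG j) _ Ux.
suff gen s : forall k (G : V -> 'rV[R]_m), (size s <= k)%N -> (forall j, smooth_on k U (fun x => G x 0 j)) ->
    (forall x, U x -> {for x, continuous (pdiff s G)}) /\
    ((size s < k)%N -> forall x, U x -> forall i, derivable (pdiff s G) x (ebasis i)).
  by split=> s sk; have [h1 h2] := gen s k F (ltac:(first [exact: sk|exact: ltnW])) sF; [exact: h1|exact: h2].
(* The last index of [s] is the first derivative taken, so the induction peels the list from its
   end. *)
elim/last_ind: s => [|s i IH] l G; rewrite ?size_rcons.
  move=> _ sG; split=> [x|/= l0 x Ux i]; first exact: cF.
  case: l l0 sG => // l _ sG.
  apply/derivable_mxP => k' j; rewrite ord1.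
  have [_ /(_ i)[h' [hh' _]]] := sG j.
  by have h := hh' x Ux; exact: ex_derive.
case: l => // l sl sG; rewrite pdiff_rcons.
have sdG j : smooth_on l U (fun x => pdiff [:: i] G x 0 j).
  have [_ /(_ i)[h' [hh' sh']]] := sG j.
  apply: smooth_on_near_eq sh' => // x Ux.
  have dG : derivable G x (ebasis i).
    apply/derivable_mxP => k' j'; rewrite ord1.
    have [_ /(_ i)[g' [gg' _]]] := sG j'.
    by have h := gg' x Ux; exact: ex_derive.
  by rewrite /= derive_mx// mxE; have h := hh' x Ux; rewrite derive_val.
exact: (IH l (pdiff [:: i] G) sl sdG).
Qed.

End SmoothFunctions.

(** * Local equations and normals of a hypersurface *)

Lemma tder_additive {R : realType} {V W : normedModType R} (M : V -> W) x :
  (forall u v, M (u - v) = M u - M v) -> tder M x M.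
Proof. by move=> MB e e0; apply: nearW => y; rewrite MB subrr normr0 mulr_ge0// ltW. Qed.

Lemma tder_quadratic_all {R : realType} {V W : normedModType R} (f : V -> W) x L (K : R) :
  0 <= K -> (forall y, `|f y - f x - L (y - x)| <= K * `|y - x| ^+ 2) -> tder f x L.
Proof. by move=> K0 fK; apply: (tder_quadratic K0); exact: nearW. Qed.

Section LocalEquation.
Context {R : realType} {d : nat}.
Local Notation V := 'rV[R]_d.
Implicit Types (Theta U : set V) (h lam : V -> R) (n : V -> V).

(** [h] is a defining function whose gradient is split into its length [lam] and direction [n]. Only
    [n], which lives on all of [U] and not just on [Theta], needs C^2 regularity; of [lam] only
    positivity is kept. *)
Definition local_equation Theta U h n lam :=
  [/\ open U, Ck_on 2 U n, forall x, U x -> enorm (n x) = 1,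
      forall x, U x -> 0 < lam x /\ tder h x (fun u => lam x * dotp (n x) u) &
      forall x, U x -> (Theta x <-> h x = 0)].

Lemma local_equation_exists Theta xi : hypersurface 3 Theta -> Theta xi ->
  exists U h n lam, U xi /\ local_equation Theta U h n lam.
Proof.
move=> hyp /hyp[U [f [Uxi [Cf [gf Tf]]]]]; have oU := Cf.1.
pose g x : V := \row_i (pdiff [:: i] f x 0 0).
have gpos x : U x -> 0 < dotp (g x) (g x).
  move=> /gf[i gi]; rewrite lt_def dotp_ge0 andbT; apply/negP => /eqP g0.
  have /rowP/(_ i) : g x = 0 by apply: dotp_eq0; rewrite g0.
  rewrite !mxE => h0; move/negP: gi; apply; apply/eqP/rowP => j; rewrite ord1 mxE; exact: h0.
have sg i : smooth_on 2 U (fun x => g x 0 i).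
  have := Ck_on_smooth 0 (Ck_on_pdiff i Cf).
  by apply: smooth_on_near_eq => // x _; rewrite mxE.
have sq : smooth_on 2 U (fun x => dotp (g x) (g x)).
  by apply: smooth_on_sum => i; exact: smooth_onM.
exists U, (fun x => f x 0 0), (fun x => (Num.sqrt (dotp (g x) (g x)))^-1 *: g x), (fun x => enorm (g x)).
split=> //; split=> // [|x Ux|x Ux|x Ux].
- apply: smooth_Ck_on => // j.
  have := smooth_onM (smooth_on_rsqrt sq gpos) (sg j).
  by apply: smooth_on_near_eq => // x _; rewrite [RHS]mxE.
- have gx : 0 < enorm (g x) by rewrite sqrtr_gt0 gpos.
  by rewrite enormZ -/(enorm (g x)) ger0_norm ?invr_ge0 ?enorm_ge0// mulVf// gt_eqF.
- have gx : 0 < enorm (g x) by rewrite sqrtr_gt0 gpos.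
  split=> //; apply: tder_eq (coord_tder 0 (Ck_on_tder (Ck_on_le _ Cf) Ux)) => // u.
  rewrite dotpZl mulrA divff ?gt_eqF// mul1r mxE dotpC.
  by apply: eq_bigr => i _; rewrite !mxE.
- rewrite Tf//; split=> [->|f0]; first by rewrite mxE.
  by apply/rowP => j; rewrite ord1 mxE.
Qed.

Lemma Ck_onN {m} k U (F : V -> 'rV[R]_m) : Ck_on k U F -> Ck_on k U (fun x => - F x).
Proof.
move=> CF; apply: smooth_Ck_on => [|j]; first exact: CF.1.
have := smooth_onM (smooth_on_cst k U (-1)) (Ck_on_smooth j CF).
by apply: smooth_on_near_eq => [|x _]; [exact: CF.1|rewrite mxE mulN1r].
Qed.

(** Reverses the orientation of the normal, so that it can be pointed to a prescribed side. *)
Lemma local_equationN Theta U h n lam : local_equation Theta U h n lam ->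
  local_equation Theta U (fun x => - h x) (fun x => - n x) lam.
Proof.
move=> [oU Cn n1 dh Th]; split; [exact: oU| |move=> x Ux|move=> x Ux|move=> x Ux].
- exact: Ck_onN.
- by rewrite enormN n1.
- have [lam0 dhx] := dh x Ux; split=> // e e0; apply: filterS (dhx e e0) => y.
  by rewrite -normrN dotpNl !opprD !opprK mulrN opprK.
- by rewrite Th//; split=> [->|/eqP]; [rewrite oppr0|rewrite oppr_eq0 => /eqP].
Qed.

Section LocalEquationTheory.
Context Theta U h n lam.
Hypothesis leq : local_equation Theta U h n lam.

Lemma local_equation_bound x (u : V) : `|lam x * dotp (n x) u| <= `|lam x| * (d%:R ^+ 2 * `|n x|) * `|u|.
Proof. by rewrite normrM -mulrA ler_wpM2l// norm_dotp_sup. Qed.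

Lemma local_equation_continuous x : U x -> {for x, continuous h}.
Proof.
case: leq => _ _ _ dh _ Ux; have [_ dhx] := dh x Ux.
by apply: (tder_continuous _ dhx (local_equation_bound x)); rewrite !mulr_ge0// exprn_ge0.
Qed.

(** Supplies points of [Theta] in a controlled position, in place of a local parametrization. *)
Lemma crossing (x y : V) : (forall s : R, 0 <= s <= 1 -> U (x + s *: (y - x))) ->
  h x <= 0 <= h y -> exists2 s : R, 0 <= s <= 1 & Theta (x + s *: (y - x)).
Proof.
move=> Uxy /andP[hx hy]; case: leq => _ _ _ dh Th.
have [|| s] := @IVT R (fun s => h (x + s *: (y - x))) 0 1 0 ler01.
- apply: continuous_in_subspaceT => s; rewrite inE /= in_itv /= => s01.
  apply: (@continuous_comp _ _ _ (fun s : R => x + s *: (y - x)) h); last first.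
    exact: local_equation_continuous (Uxy s s01).
  apply: continuousD; first exact: cst_continuous.
  by apply: scalel_continuous.
- by rewrite scale0r addr0 scale1r subrKC ge_min le_max hx hy orbT.
rewrite in_itv /= => s01 hs; exists s => //.
by apply/Th => //; exact: Uxy.
Qed.

(** Along a curve in [Theta] the function [h] is constantly 0, so its derivative
    [lam x * dotp (n x) w] vanishes while [lam x] is positive. *)
Lemma local_equation_unit_normal x : U x -> Theta x -> unit_normal Theta x (n x).
Proof.
case: leq => oU _ n1 dh Th Ux Tx; split; first exact: n1.
move=> w [gamma [g0 Tg dg gw]]; have [lam0 dhx] := dh x Ux.
have tg := derivable_tder dg; rewrite gw in tg.
have cg : {for (0 : R), continuous gamma}.
  by apply: (tder_continuous (normr_ge0 w) tg) => u; rewrite normrZ mulrC.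
have hgamma : tder (h \o gamma) 0 (fun t => lam x * dotp (n x) (t *: w)).
  rewrite -g0 in dhx *.
  apply: (tder_comp (normr_ge0 w) _ tg dhx _ (local_equation_bound _)) => [|u|u v].
  - by rewrite !mulr_ge0// exprn_ge0.
  - by rewrite normrZ mulrC.
  - by rewrite dotpDr mulrDr.
have Unear : \forall t \near (0 : R), U (gamma t).
  by apply: cg; rewrite g0; exact: open_nbhs_nbhs.
have flat : \forall t \near (0 : R), `|(h \o gamma) t - (h \o gamma) 0| <= 0 * `|t - 0|.
  apply: filterS2 Tg Unear => t /= + Ut => /(Th _ Ut) ->.
  by rewrite g0 (Th _ Ux).1// subrr normr0 mul0r.
have homog (k t : R) : lam x * dotp (n x) ((k *: t) *: w) = k *: (lam x * dotp (n x) (t *: w)).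
  by rewrite -[k *: t]/(k * t) !dotpZr -[k *: _]/(k * _); ring.
have := tder_lip_bound hgamma homog flat 1.
rewrite mul0r normr_le0 scale1r mulf_eq0 gt_eqF//= => /eqP //.
Qed.

(* The implicit function theorem is replaced by the intermediate value theorem along the normal:
   [Theta] contains [xi + k (w + s n)] with [|s| <= e], for every tangent [w] and small [k]. *)
Lemma normal_vector_colinear xi z : U xi -> Theta xi ->
  (forall eta, Theta eta -> 2 * dotp z (eta - xi) <= enorm (eta - xi) ^+ 2) ->
  z = dotp z (n xi) *: n xi.
Proof.
move=> Uxi Txi zprox; have [oU _ n1 dh Th] := leq; have [lam0 dhx] := dh xi Uxi.
set nu := n xi in dhx *; have nu1 : enorm nu = 1 by exact: n1.
have nunu : dotp nu nu = 1 by rewrite -sqr_enorm nu1 expr1n.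
(* Applied to the tangential part [w] of [z], for which [dotp z w = dotp w w], this one-sided
   inequality already forces [w = 0]. *)
suff tang w : dotp nu w = 0 -> dotp z w <= 0.
  pose w := z - dotp z nu *: nu.
  have w0 : dotp nu w = 0.
    by rewrite /w dotpDr dotpNr dotpZr nunu (dotpC nu); ring.
  have := tang w w0; have : dotp w w = dotp z w.
    by rewrite {1}/w dotpDl dotpNl dotpZl w0; ring.
  move=> <- /dotp_eq0; rewrite /w => /eqP; rewrite subr_eq0 => /eqP //.
move=> nw; apply/ler_addgt0Pr => e' e'0; rewrite add0r.
have Z1 : 0 < 2 * enorm z + 1 by rewrite ltr_wpDl// mulr_ge0// enorm_ge0.
have [e e0 <-] : exists2 e : R, 0 < e & e * (2 * enorm z + 1) = e'.
  by exists (e' / (2 * enorm z + 1)); rewrite ?divr_gt0// divfK// gt_eqF.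
have We : 0 < enorm w + e by rewrite ltr_wpDl// enorm_ge0.
have r0 : 0 < lam xi * e / (2 * (enorm w + e)) by rewrite divr_gt0 ?mulr_gt0.
have Un : \forall y \near xi, U y by exact: open_nbhs_nbhs.
have [r rpos Hr] : exists2 r : R, 0 < r & forall y, enorm (y - xi) < r -> U y /\
    `|h y - h xi - lam xi * dotp nu (y - xi)| <= lam xi * e / (2 * (enorm w + e)) * `|y - xi|.
  by apply: nbhs_enorm; apply: filterS2 Un (dhx _ r0) => y.
(* The first bound keeps all test points in the ball of radius [r]; the second makes the quadratic
   term of [zprox], after division by [k], at most [e]. *)
pose k : R := Num.min (r / (2 * (enorm w + e))) (e / (enorm w + e) ^+ 2).
have k0 : 0 < k by rewrite lt_min !divr_gt0 ?mulr_gt0 ?exprn_gt0.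
have kr : k * (enorm w + e) < r.
  apply: (@le_lt_trans _ _ (r / 2)); last by rewrite ltr_pdivrMr// ltr_pMr// ltr1n.
  rewrite -ler_pdivlMr// (_ : r / 2 / (enorm w + e) = r / (2 * (enorm w + e))).
    by rewrite /k ge_min lexx.
  by field; rewrite gt_eqF.
have ke : k * (enorm w + e) ^+ 2 <= e.
  by rewrite -ler_pdivlMr ?exprn_gt0// /k ge_min lexx orbT.
have est s : `|s| <= e -> enorm (k *: (w + s *: nu)) <= k * (enorm w + e).
  move=> se; rewrite enormZ gtr0_norm// ler_pM2l// (le_trans (enormD _ _))// lerD2l.
  by rewrite enormZ nu1 mulr1.
have Upt s : `|s| <= e -> U (xi + k *: (w + s *: nu)).
  by move=> se; apply: (Hr _ _).1; rewrite addrC addKr (le_lt_trans (est s se)).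
have hxi : h xi = 0 by apply/Th.
(* The value is [k * lam xi * s] up to half of [k * lam xi * e], so [h] has opposite signs at
   [s = - e] and [s = e]. *)
have hpt s : `|s| <= e -> `|h (xi + k *: (w + s *: nu)) - k * lam xi * s| <= k * lam xi * e / 2.
  move=> se; have := (Hr (xi + k *: (w + s *: nu)) _).2.
  rewrite (addrC xi) addrK (le_lt_trans (est s se))// hxi subr0 => /(_ isT).
  rewrite dotpZr dotpDr nw dotpZr nunu add0r mulr1 mulrA (mulrC (lam xi) k) => /le_trans; apply.
  apply: (@le_trans _ _ (lam xi * e / (2 * (enorm w + e)) * (k * (enorm w + e)))).
    by rewrite ler_wpM2l ?(ltW r0)// (le_trans (mx_norm_le_enorm _))// est.
  by rewrite le_eqVlt; apply/orP; left; apply/eqP; field; rewrite gt_eqF.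
have kle : 0 < k * lam xi * e by rewrite !mulr_gt0.
have ee : `|e| <= e by rewrite gtr0_norm.
have ee' : `|- e| <= e by rewrite normrN.
pose xm := xi + k *: (w + (- e) *: nu); pose xp := xi + k *: (w + e *: nu).
have lineE s : xm + s *: (xp - xm) = xi + k *: (w + ((2 * s - 1) * e) *: nu).
  by rewrite /xm /xp; vec.
have s1e s : 0 <= s <= 1 -> `|(2 * s - 1) * e| <= e.
  move=> /andP[s0 s1]; rewrite normrM (gtr0_norm e0) ler_piMl ?(ltW e0)// ler_norml; lra.
have [||s /s1e se] := @crossing xm xp.
- by move=> s /s1e se; rewrite lineE; exact: Upt.
- by have := hpt _ ee; have := hpt _ ee'; rewrite -/xm -/xp !ler_norml; lra.
rewrite lineE; set s' := _ * e in se *; move=> /zprox; rewrite (addrC xi) addrK => h1.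
have h2 : enorm (k *: (w + s' *: nu)) ^+ 2 <= (k * (enorm w + e)) ^+ 2.
  by rewrite ler_sqr ?nnegrE ?enorm_ge0 ?mulr_ge0 ?(ltW k0) ?(ltW We)// est.
rewrite dotpZr dotpDr dotpZr in h1.
have h3 : `|s' * dotp z nu| <= e * enorm z.
  rewrite normrM ler_pM//; have := norm_dotp z nu; by rewrite nu1 mulr1.
have h4 : k * (2 * (dotp z w + s' * dotp z nu)) <= k * (k * (enorm w + e) ^+ 2).
  by move: h1 h2; rewrite exprMn; lra.
have := mulr_gt0 e0 Z1.
rewrite ler_pM2l// in h4; move: h3; rewrite ler_norml => /andP[h3 _]; lra.
Qed.

Lemma normal_tder x : U x -> tder n x (fun u => u *m jac n x).
Proof. by case: leq => _ Cn _ _ _; exact: (Ck_on_tder (Ck_on_le _ Cn)). Qed.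

(** For unit vectors [dotp (n x) (n y)] equals 1 minus half the squared length of [n y - n x]. It is
    flat to second order at [x], so its derivative, computed also by the chain rule, is 0. *)
Lemma dotp_jac_normal x (w : V) : U x -> dotp (n x) (w *m jac n x) = 0.
Proof.
move=> Ux; have [oU _ n1 _ _] := leq; have tn := normal_tder Ux.
have K0 : 0 <= d%:R * `|jac n x| by rewrite mulr_ge0.
have K'0 : 0 <= d%:R ^+ 2 * `|n x| by rewrite mulr_ge0// exprn_ge0.
have dd : tder (dotp (n x)) (n x) (dotp (n x)).
  by apply: tder_additive => u v; rewrite dotpDr dotpNr.
have t1 : tder (dotp (n x) \o n) x (fun u => dotp (n x) (u *m jac n x)).
  apply: (tder_comp K0 K'0 tn dd (norm_mulmx_rV _) (norm_dotp_sup _)) => u v.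
  by rewrite dotpDr.
have t2 : tder (dotp (n x) \o n) x (fun=> 0).
  pose C := d%:R * (d%:R * `|jac n x| + 1).
  have C0 : 0 <= C by rewrite mulr_ge0// addr_ge0.
  apply: (@tder_quadratic _ _ _ _ _ _ (C ^+ 2)); first by rewrite exprn_ge0.
  have Un : \forall y \near x, U y by exact: open_nbhs_nbhs.
  apply: filterS2 Un (tder_near_lip tn (norm_mulmx_rV _)) => y Uy ny /=.
  have sq : dotp (n y - n x) (n y - n x) <= (C * `|y - x|) ^+ 2.
    rewrite -le_enorm; last by rewrite mulr_ge0.
    apply: le_trans (enorm_le_mx_norm _) _.
    by rewrite /C -mulrA ler_wpM2l.
  have := dotp_ge0 (n y - n x); move: sq.
  rewrite dotp_sqrB (dotpC (n y)) -!sqr_enorm !n1// expr1n exprMn subr0 ler_norml; lra.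
have [_ <-] := tder_is_derive w t1 (fun k u => ltac:(by move=> /=; rewrite -scalemxAl dotpZr)).
by have [_ ->] := tder_is_derive w t2 (fun k u => ltac:(by move=> /=; rewrite [_ *: _]mulr0)).
Qed.

Lemma curve_tder (xi w nu : V) (kap k : R) :
  tder (fun k : R => xi + k *: w + (kap * k ^+ 2) *: nu) k (fun t => t *: (w + (2 * kap * k) *: nu)).
Proof.
apply: (@tder_quadratic_all _ _ _ _ _ _ (`|kap| * `|nu|)) => [|y]; first by rewrite mulr_ge0.
have -> : xi + y *: w + (kap * y ^+ 2) *: nu - (xi + k *: w + (kap * k ^+ 2) *: nu) -
    (y - k) *: (w + (2 * kap * k) *: nu) = (kap * (y - k) ^+ 2) *: nu by vec.
by rewrite normrZ normrM normrX mulrAC.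
Qed.

Lemma norm_scale_le (v : V) (t : R) : `|t *: v| <= `|v| * `|t|.
Proof. by rewrite normrZ mulrC. Qed.

(* Along [xi + k w + kap k^2 n] the derivative of the equation [h] is
   [lam k (2 kap + w . Dn w) + o(k)], so second order information on [h] is not needed. *)
Lemma curve_sign xi (w : V) (kap : R) : U xi -> h xi = 0 -> dotp (n xi) w = 0 ->
  2 * kap + dotp (w *m jac n xi) w != 0 ->
  exists2 k0 : R, 0 < k0 & forall k, 0 < k < k0 ->
    let c := xi + k *: w + (kap * k ^+ 2) *: n xi in
    U c /\ 0 < (2 * kap + dotp (w *m jac n xi) w) * h c.
Proof.
move=> Uxi hxi nw D0; have [oU _ n1 dh _] := leq.
have tn := normal_tder Uxi.
set nu := n xi in nw *; have nunu : dotp nu nu = 1 by rewrite -sqr_enorm /nu n1// expr1n.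
set D := 2 * kap + _ in D0 *.
pose c (k : R) := xi + k *: w + (kap * k ^+ 2) *: nu.
have c0 : c 0 = xi by rewrite /c scale0r expr0n mulr0 scale0r !addr0.
have tc k : tder c k (fun t => t *: (w + (2 * kap * k) *: nu)) := curve_tder _ _ _ _ _.
have tnc : tder (n \o c) 0 (fun t => (t *: w) *m jac n xi).
  rewrite -c0 in tn *.
  apply: (tder_comp (normr_ge0 w) _ _ tn _ (norm_mulmx_rV _)) => [| |u|u v].
  - by rewrite mulr_ge0.
  - by apply: tder_eq (tc 0) => t; rewrite mulr0 scale0r addr0.
  - exact: norm_scale_le.
  - by rewrite mulmxDl.
have cn : {for (0 : R), continuous (n \o c)}.
  apply: (@tder_continuous _ _ _ _ _ _ (`|w *m jac n xi|) _ tnc) => // u.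
  by rewrite -scalemxAl norm_scale_le.
have cc k : {for k, continuous c}.
  by apply: (tder_continuous (normr_ge0 _) (tc k)) => u; exact: norm_scale_le.
pose B := d%:R ^+ 2 * (`|w| + 2 * `|kap| * `|nu|) + 1.
have B0 : 0 < B by rewrite ltr_wpDl// mulr_ge0// ?exprn_ge0// addr_ge0// !mulr_ge0.
have Dn : 0 < `|D| by rewrite normr_gt0.
have e0 : 0 < `|D| / 2 / B by rewrite !divr_gt0.
have [r r0 Hr] : exists2 r : R, 0 < r & forall k, `|k| < r ->
    [/\ U (c k), `|n (c k) - nu - (k *: w) *m jac n xi| <= `|D| / 2 / B * `|k| &
      `|n (c k) - nu| <= `|D| / 2 / B].
  have Uc : \forall k \near (0 : R), U (c k).
    by apply: (cc 0); rewrite c0; exact: open_nbhs_nbhs.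
  have /nbhs_normP[r /= r0 Hr] : \forall k \near (0 : R), U (c k) /\
      (`|n (c k) - n (c 0) - ((k - 0) *: w) *m jac n xi| <= `|D| / 2 / B * `|k - 0| /\
       `|n (c k) - n (c 0)| <= `|D| / 2 / B).
    have nn : \forall k \near (0 : R),
        `|n (c k) - n (c 0) - ((k - 0) *: w) *m jac n xi| <= `|D| / 2 / B * `|k - 0| /\
        `|n (c k) - n (c 0)| <= `|D| / 2 / B.
      by apply: filterS2 (tnc _ e0) ((continuous_distP _ _).1 cn _ e0) => k.
    by apply: filterS2 Uc nn => k.
  exists r => // k kr; have := Hr k; rewrite /ball_ /= sub0r normrN c0 subr0 => /(_ kr)[? []].
  by split.
exists r => // k /andP[k0 kr]; rewrite -/(c k).
have kn : `|k| < r by rewrite gtr0_norm.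
split; first by case: (Hr k kn).
(* The derivative of [h] along the curve is [lam * psi], and [psi t] is [t * D] up to an error of at
   most [t * |D| / 2]; hence it has the sign of [D]. *)
pose psi t := dotp (n (c t)) (w + (2 * kap * t) *: nu).
have psiD t : 0 < t < r -> 0 < D * psi t.
  move=> /andP[t0 tr]; have [|_ h1 h2] := Hr t; first by rewrite gtr0_norm.
  rewrite (gtr0_norm t0) in h1.
  have psiE : psi t = t * D + (dotp (n (c t) - nu - (t *: w) *m jac n xi) w +
      2 * kap * t * dotp (n (c t) - nu) nu).
    rewrite /psi /D -scalemxAl !dotpDl !dotpDr !dotpNl dotpZl dotpZr nw nunu; ring.
  have small : `|dotp (n (c t) - nu - (t *: w) *m jac n xi) w + 2 * kap * t * dotp (n (c t) - nu) nu|
      <= t * (`|D| / 2).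
    apply: le_trans (ler_normD _ _) _.
    have b1 := norm_dotp_sup (n (c t) - nu - (t *: w) *m jac n xi) w.
    have b2 := norm_dotp_sup (n (c t) - nu) nu.
    have b1' : d%:R ^+ 2 * `|n (c t) - nu - (t *: w) *m jac n xi| * `|w| <=
        d%:R ^+ 2 * (`|D| / 2 / B * t) * `|w|.
      by rewrite ler_wpM2r// ler_wpM2l// exprn_ge0.
    have b2' : d%:R ^+ 2 * `|n (c t) - nu| * `|nu| <= d%:R ^+ 2 * (`|D| / 2 / B) * `|nu|.
      by rewrite ler_wpM2r// ler_wpM2l// exprn_ge0.
    have b2'' : `|2 * kap * t * dotp (n (c t) - nu) nu| <=
        2 * `|kap| * t * (d%:R ^+ 2 * (`|D| / 2 / B) * `|nu|).
      rewrite !normrM (gtr0_norm t0) normr_nat ler_wpM2l ?mulr_ge0 ?(ltW t0)//.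
      exact: le_trans b2 b2'.
    apply: le_trans (lerD (le_trans b1 b1') b2'') _.
    have -> : d%:R ^+ 2 * (`|D| / 2 / B * t) * `|w| +
        2 * `|kap| * t * (d%:R ^+ 2 * (`|D| / 2 / B) * `|nu|) = t * (`|D| / 2 / B * (B - 1)).
      by rewrite /B; ring.
    rewrite ler_pM2l//; apply: (@le_trans _ _ (`|D| / 2 / B * B)); last by rewrite divfK// gt_eqF.
    by rewrite ler_pM2l// gerBl.
  move: small; set E := _ + _ * dotp _ nu in psiE *; rewrite psiE => small.
  have h3 : `|D * E| <= `|D| * (t * (`|D| / 2)) by rewrite normrM ler_wpM2l.
  have h4 : 0 < t * `|D| ^+ 2 by rewrite mulr_gt0// exprn_gt0.
  have h5 : D ^+ 2 = `|D| ^+ 2 by rewrite real_normK ?num_real.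
  move: h3; rewrite ler_norml => /andP[h3 _].
  have -> : D * (t * D + E) = t * D ^+ 2 + D * E by ring.
  rewrite h5; lra.
have dhc t : 0 <= t <= k -> is_derive t 1 (h \o c) (lam (c t) * psi t).
  move=> /andP[t0 tk]; have [|Uct _ _] := Hr t; first by rewrite ger0_norm//; exact: le_lt_trans kr.
  have [_ dhx] := dh _ Uct.
  have := tder_comp (normr_ge0 _) _ (tc t) dhx (norm_scale_le _) (local_equation_bound _).
  move=> /(_ ltac:(by rewrite !mulr_ge0// exprn_ge0)) /(_ ltac:(by move=> u v; rewrite dotpDr mulrDr)).
  move=> hd; have : is_derive t 1 (h \o c) (lam (c t) * dotp (n (c t)) (1 *: (w + (2 * kap * t) *: nu))).
    have hd' : tder (h \o c) t (fun s : R => lam (c t) * dotp (n (c t)) (s *: (w + (2 * kap * t) *: nu))).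
      exact: hd.
    apply: (tder_is_derive _ hd') => a u.
    by rewrite -[a *: u]/(a * u) !dotpZr -[a *: _]/(a * _); ring.
  by rewrite scale1r.
have [||t] := @MVT _ (h \o c) (fun t => lam (c t) * psi t) 0 k k0.
- by move=> t; rewrite in_itv /= => /andP[? ?]; apply: dhc; rewrite !ltW.
- apply: derivable_within_continuous => t; rewrite in_itv /= => /dhc hd; exact: ex_derive.
rewrite in_itv /= c0 hxi !subr0 => /andP[t0 tk] ->.
have [|Uct _ _] := Hr t; first by rewrite gtr0_norm//; exact: lt_trans kr.
have [lam0 _] := dh _ Uct.
have tr : 0 < t < r by rewrite t0 (lt_trans tk).
by rewrite mulrA mulr_gt0// mulrCA mulr_gt0// psiD.
Qed.

(* [s] lies below the reach [t] of [Theta] along [n xi], so [Id + s Dn] has trivial kernel. *)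
Lemma normal_map_inj xi (s t : R) (w : V) : U xi -> Theta xi -> 0 < s < t ->
  (forall eta, Theta eta -> 2 * t * dotp (n xi) (eta - xi) <= enorm (eta - xi) ^+ 2) ->
  w + s *: (w *m jac n xi) = 0 -> w = 0.
Proof.
move=> Uxi Txi /andP[s0 st] prox wker; have [oU _ n1 _ Th] := leq.
have nunu : dotp (n xi) (n xi) = 1 by rewrite -sqr_enorm n1// expr1n.
have nw : dotp (n xi) w = 0.
  have := congr1 (dotp (n xi)) wker.
  by rewrite dotpDr dotpZr dotp_jac_normal// mulr0 addr0 dotp0r.
have sn0 : s != 0 by rewrite gt_eqF.
have wJ : dotp (w *m jac n xi) w = - (dotp w w / s).
  have := congr1 (dotp^~ w) wker; rewrite dotpDl dotpZl dotp0l => h1.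
  by apply: (mulfI sn0); rewrite mulrN mulrCA divff// mulr1; lra.
have hxi : h xi = 0 by apply/Th.
apply: dotp_eq0; rewrite leNgt; apply/negP => W0.
set W := dotp w w in W0 wJ.
have t0 : 0 < t by exact: lt_trans st.
(* The kernel relation gives [dotp (w *m jac n xi) w = - W / s]. The coefficient [W / (2 t')] thus
   makes the quantity of [curve_sign] negative, and [W / s] makes it positive, so [Theta] meets the
   segment between the two curves. Such a point is at height at least [k ^ 2 W / (2 t')], which
   violates [prox] because [t' < t]. *)
pose t' := (s + t) / 2; have [st' t't] : s < t' /\ t' < t by rewrite /t'; split; lra.
have t'0 : 0 < t' by exact: lt_trans st'.
have D1 : 2 * (W / (2 * t')) + dotp (w *m jac n xi) w < 0.
  rewrite wJ (_ : 2 * (W / (2 * t')) = W / t'); last by field; rewrite gt_eqF.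
  by rewrite subr_lt0 ltr_pM2l// ltf_pV2.
have D2 : 0 < 2 * (W / s) + dotp (w *m jac n xi) w.
  by rewrite wJ; have : 0 < W / s by [rewrite divr_gt0]; lra.
have [k1 k10 H1] := curve_sign Uxi hxi nw (ltr0_neq0 D1).
have [k2 k20 H2] := curve_sign Uxi hxi nw (lt0r_neq0 D2).
have [r r0 Hr] : exists2 r, 0 < r & forall y, enorm (y - xi) < r -> U y.
  by apply: nbhs_enorm; exact: open_nbhs_nbhs.
set kap1 := W / (2 * t') in D1 H1; set kap2 := W / s in D2 H2.
have kap10 : 0 < kap1 by apply: divr_gt0 => //; exact: mulr_gt0.
have kap20 : 0 < kap2 by exact: divr_gt0.
have kap12 : kap1 <= kap2.
  by rewrite /kap1 /kap2 ler_pM2l// lef_pV2 ?posrE ?mulr_gt0//; lra.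
have gap : W < 2 * t * kap1.
  rewrite (_ : 2 * t * kap1 = W * (t / t')); last by rewrite /kap1; field; rewrite gt_eqF.
  by rewrite ltr_pMr// ltr_pdivlMr// mul1r.
pose B := enorm w + kap2.
have B0 : 0 < B by rewrite ltr_wpDl// enorm_ge0.
have K2 : 0 < 2 * kap2 ^+ 2 by rewrite mulr_gt0// exprn_gt0.
(* [k * B < r] keeps the segment in [U]; the last bound makes the fourth-order term of [prox]
   smaller than the gap between [2 t kap1] and [W]. *)
have [k [k0 kk1 kk2 kle1 [kB kgap]]] : exists k : R, [/\ 0 < k, k < k1, k < k2, k <= 1 &
    k * B < r /\ k * kap2 ^+ 2 < 2 * t * kap1 - W].
  exists (Num.min (Num.min (k1 / 2) (k2 / 2))
    (Num.min 1 (Num.min (r / B / 2) ((2 * t * kap1 - W) / (2 * kap2 ^+ 2))))).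
  have gap0 : 0 < 2 * t * kap1 - W by rewrite subr_gt0.
  set k := Num.min _ _.
  have kp : 0 < k by rewrite /k !lt_min ltr01 !divr_gt0.
  have : k <= k by []; rewrite {2}/k !le_min => /and3P[/andP[a1 a2] a3 /andP[a4 a5]].
  split=> //; try by lra.
  split.
    apply: le_lt_trans (_ : r / B / 2 * B < r); first by rewrite ler_pM2r.
    by rewrite mulrAC divfK ?gt_eqF//; lra.
  move: a5; rewrite ler_pdivlMr// mulrCA => a5.
  have : 0 < k * kap2 ^+ 2 by apply: mulr_gt0 => //; exact: exprn_gt0.
  move: gap a5; move: (k * _) => z; lra.
pose c kap := xi + k *: w + (kap * k ^+ 2) *: n xi.
have Uc kap : kap1 <= kap <= kap2 -> U (c kap).
  move=> /andP[ka kb]; apply: Hr; apply: le_lt_trans kB.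
  have -> : c kap - xi = k *: w + (kap * k ^+ 2) *: n xi by rewrite /c; vec.
  rewrite (le_trans (enormD _ _))// !enormZ n1// mulr1.
  rewrite mulrDr (gtr0_norm k0) lerD2l normrM normrX (gtr0_norm k0) mulrC expr2 -mulrA.
  rewrite ler_wpM2l ?(ltW k0)// ger0_norm; last by apply: le_trans ka; exact: ltW.
  by apply: le_trans kb; rewrite ler_piMl//; apply: le_trans ka; exact: ltW.
have hc1 : h (c kap1) < 0.
  have [|_] := H1 k; first by rewrite k0.
  by rewrite -/(c kap1) nmulr_rgt0.
have hc2 : 0 < h (c kap2).
  have [|_] := H2 k; first by rewrite k0.
  by rewrite -/(c kap2) pmulr_rgt0.
have lineE z : c kap1 + z *: (c kap2 - c kap1) = c (kap1 + z * (kap2 - kap1)).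
  by rewrite /c; vec.
have kz z : 0 <= z <= 1 -> kap1 <= kap1 + z * (kap2 - kap1) <= kap2.
  move=> /andP[z0 z1]; rewrite lerDl mulr_ge0 ?subr_ge0//= -lerBrDl.
  by rewrite ler_piMl// subr_ge0.
have [||z z01] := @crossing (c kap1) (c kap2).
- by move=> z z01; rewrite lineE; apply: Uc; exact: kz.
- by rewrite !ltW.
rewrite lineE; have /andP[ka kb] := kz _ z01; set kap := kap1 + _ in ka kb * => /prox.
have kap0 : 0 <= kap by apply: le_trans ka; exact: ltW.
have -> : c kap - xi = k *: (w + (kap * k) *: n xi) by rewrite /c; vec.
rewrite sqr_enorm !dotpZl !dotpZr dotp_sqrD !dotpDr !dotpZl !dotpZr nunu (dotpC w) nw -/W => h1.
have h2 : k ^+ 2 * (2 * t * kap) <= k ^+ 2 * (W + (k * kap) ^+ 2) by move: h1; lra.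
rewrite ler_pM2l ?exprn_gt0// in h2.
have h3 : (k * kap) ^+ 2 <= k * kap2 ^+ 2.
  rewrite exprMn expr2 -mulrA ler_wpM2l ?(ltW k0)//.
  apply: (@le_trans _ _ (kap ^+ 2)); first by rewrite ler_piMl// exprn_ge0.
  by rewrite lerXn2r// nnegrE// ltW.
have h4 : 2 * t * kap1 <= 2 * t * kap by rewrite ler_pM2l// mulr_gt0.
lra.
Qed.

End LocalEquationTheory.
End LocalEquation.

(** * Regularity of the nearest-point projection *)

Section ProjectionC1.
Context {R : realType} {d : nat}.
Local Notation V := 'rV[R]_d.
Context (Theta : set V) (eps : R) (p : V -> V).
Hypothesis proj : nearest_projection Theta eps p.
Hypothesis hyp : hypersurface 3 Theta.
Local Notation T := (tube Theta eps).
Local Notation delta x := (enorm (x - p x)).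

Lemma projection_obtuse x eta : T x -> Theta eta ->
  2 * dotp (x - p x) (eta - p x) <= enorm (eta - p x) ^+ 2.
Proof.
move=> Tx He; have [_ pin pmin _] := proj.
have h : enorm (x - p x) ^+ 2 <= enorm (x - eta) ^+ 2.
  by rewrite ler_sqr ?nnegrE ?enorm_ge0// pmin.
have E : x - eta = (x - p x) - (eta - p x) by vec.
move: h; rewrite E !sqr_enorm (dotp_sqrB _ (eta - p x)); lra.
Qed.

Lemma continuous_dotp {U : normedModType R} (f g : U -> V) x :
  {for x, continuous f} -> {for x, continuous g} -> {for x, continuous (fun y => dotp (f y) (g y))}.
Proof.
move=> cf cg; apply: continuous_sum => i.
by apply: continuousM; exact: continuous_coord.
Qed.

Lemma continuous_pos_near {U : normedModType R} (f : U -> R) x :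
  {for x, continuous f} -> 0 < f x -> \forall y \near x, 0 < f y.
Proof.
move=> /continuous_distP cf fx; have f2 : 0 < f x / 2 by rewrite divr_gt0.
by apply: filterS (cf _ f2) => y; rewrite ler_norml => /andP[h _]; lra.
Qed.

(** A local equation at the foot point whose normal points to the side of [x0], so that [x - p x] is
    a positive multiple of the normal for all [x] near [x0]. *)
Definition outward_equation x0 U h n lam :=
  [/\ local_equation Theta U h n lam, U (p x0) &
    \forall x \near x0, [/\ T x, 0 < delta x, U (p x) & x - p x = delta x *: n (p x)]].

(** [x - p x] is a multiple of [n (p x)] by [normal_vector_colinear]; the sign at [x0] is fixed by
    possibly negating the equation and persists by continuity. *)
Lemma outward_equation_exists x0 : T x0 -> 0 < delta x0 ->
  exists U h n lam, outward_equation x0 U h n lam.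
Proof.
move=> Tx0 d0; have [_ pin _ _] := proj.
have [U [h [n [lam [Up leq]]]]] := local_equation_exists hyp (pin _ Tx0).
have col U' h' n' lam' (leq' : local_equation Theta U' h' n' lam') x : T x -> U' (p x) ->
    x - p x = dotp (x - p x) (n' (p x)) *: n' (p x).
  move=> Tx Ux; apply: (normal_vector_colinear leq' Ux (pin _ Tx)) => eta He.
  exact: projection_obtuse.
have good U' h' n' lam' : local_equation Theta U' h' n' lam' -> U' (p x0) ->
    0 < dotp (x0 - p x0) (n' (p x0)) -> outward_equation x0 U' h' n' lam'.
  move=> leq' Up' dpos; split=> //; have [oU' _ n1 _ _] := leq'.
  have cp := projection_continuous proj Tx0.
  have cn : {for x0, continuous (n' \o p)}.
    apply: continuous_comp => //.
    by apply: (tder_continuous _ (normal_tder leq' Up') (norm_mulmx_rV _)); rewrite mulr_ge0.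
  have cz : {for x0, continuous (fun x : V => x - p x)}.
    by apply: continuousB => //; exact: cvg_id.
  have npos : \forall x \near x0, 0 < dotp (x - p x) (n' (p x)).
    by apply: continuous_pos_near => //; exact: continuous_dotp.
  have nU : \forall x \near x0, U' (p x) by apply: cp; exact: open_nbhs_nbhs.
  have nTU : \forall x \near x0, T x /\ U' (p x) by apply: filterS2 (tube_near proj Tx0) nU => x.
  apply: filterS2 nTU npos => x [Tx Ux] zn.
  have xE := col _ _ _ _ leq' x Tx Ux.
  have dE : delta x = dotp (x - p x) (n' (p x)).
    by rewrite {1}xE enormZ n1// mulr1 gtr0_norm.
  by split=> //; rewrite dE.
have [dn|dn] := ltP 0 (dotp (x0 - p x0) (n (p x0))).
  by exists U, h, n, lam; exact: good.
exists U, (fun x => - h x), (fun x => - n x), lam; apply: good => //; first exact: local_equationN.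
rewrite dotpNr oppr_gt0 lt_def dn andbT eq_sym; apply/negP => /eqP d00.
by move: d0; rewrite (col _ _ _ _ leq x0 Tx0 Up) d00 scale0r enorm0 ltxx.
Qed.

Section OffTheta.
Context (x0 : V) (U : set V) (h : V -> R) (n : V -> V) (lam : V -> R).
Hypothesis oeq : outward_equation x0 U h n lam.
Hypothesis dx0 : delta x0 < eps / 4.

Let oeq_near : \forall x \near x0, [/\ T x, 0 < delta x <= eps / 4, U (p x) & x - p x = delta x *: n (p x)].
Proof.
have [_ _ nx] := oeq; have [Tx0 _ _ _] := nbhs_singleton nx.
have k0 : 0 < eps / 4 - delta x0 by rewrite subr_gt0.
apply: filterS2 nx (near_enorm x0 k0) => x [Tx dx Ux xE] xk; split=> //.
by rewrite dx /=; have := tube_dist_lip proj Tx0 Tx; lra.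
Qed.

Let oeq_near2 : \forall x \near x0, \forall y \near x,
  [/\ T y, 0 < delta y <= eps / 4, U (p y) & y - p y = delta y *: n (p y)].
Proof. exact: nbhs_interior oeq_near. Qed.

(** The old foot point [p x] is a competitor for [y]; expanding [enorm (y - p x)] gives a one-sided
    first-order bound with explicit quadratic error. *)
Lemma dist_le_linear x y : T x -> T y -> 0 < delta x -> U (p x) -> x - p x = delta x *: n (p x) ->
  enorm (y - x) <= delta x / 2 ->
  delta y <= delta x + dotp (y - x) (n (p x)) + enorm (y - x) ^+ 2 / delta x.
Proof.
move=> Tx Ty dx Ux xE yx; have [[_ _ n1 _ _] _ _] := oeq; have [_ pin pmin _] := proj.
apply: le_trans (pmin _ _ Ty (pin _ Tx)) _.
have un := norm_dotp (y - x) (n (p x)); rewrite n1// mulr1 in un.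
have /andP[un1 un2] : - (delta x / 2) <= dotp (y - x) (n (p x)) <= delta x / 2.
  by rewrite -ler_norml (le_trans un).
have e0 : 0 <= enorm (y - x) ^+ 2 / delta x by rewrite divr_ge0 ?exprn_ge0 ?enorm_ge0.
rewrite le_enorm; last by lra.
have -> : y - p x = (y - x) + delta x *: n (p x) by rewrite -xE; vec.
rewrite dotp_sqrD dotpZr !dotpZl dotpZr -(sqr_enorm (n (p x))) n1// -sqr_enorm.
move: (enorm (y - x)) un un1 un2 e0 => e; move: (dotp (y - x) (n (p x))) => A; move: (delta x) dx => D dx.
move=> un un1 un2 e0; have Dn0 : D != 0 by rewrite gt_eqF.
have -> : (D + A + e ^+ 2 / D) ^+ 2 =
    (D + A) ^+ 2 + 2 * e ^+ 2 + 2 * A * (e ^+ 2 / D) + (e ^+ 2 / D) ^+ 2 by field.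
have h1 : - e ^+ 2 <= 2 * A * (e ^+ 2 / D).
  have : - D * (e ^+ 2 / D) <= 2 * A * (e ^+ 2 / D) by rewrite ler_wpM2r//; lra.
  by rewrite mulNr mulrCA divff// mulr1.
have := sqr_ge0 (e ^+ 2 / D); have := sqr_ge0 A; rewrite expr1n; lra.
Qed.

Lemma normal_projection_continuous : \forall x \near x0, {for x, continuous (n \o p)}.
Proof.
have [leq _ _] := oeq.
apply: filterS oeq_near => x [Tx _ Ux _]; apply: continuous_comp.
  exact: projection_continuous Tx.
by apply: (tder_continuous _ (normal_tder leq Ux) (norm_mulmx_rV _)); rewrite mulr_ge0.
Qed.

(** [dist_le_linear] gives the upper bound and, with [x] and [y] exchanged, the lower one.
    Continuity of [n \o p] replaces [n (p y)] by [n (p x)], so differentiability of [p] does not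
    enter and can be deduced afterwards. *)
Lemma dist_tder : \forall x \near x0, tder (fun x : V => delta x) x (fun u => dotp (n (p x)) u).
Proof.
near=> x; have [Tx /andP[dx _] Ux xE] : [/\ T x, 0 < delta x <= eps / 4, U (p x) & x - p x = delta x *: n (p x)].
  by near: x; exact: oeq_near.
have near_x : \forall y \near x,
    [/\ T y, 0 < delta y <= eps / 4, U (p y) & y - p y = delta y *: n (p y)].
  by near: x; exact: oeq_near2.
have cn : {for x, continuous (n \o p)} by near: x; exact: normal_projection_continuous.
move=> e e0.
pose D : R := d%:R + 1; have D0 : 0 < D by rewrite ltr_wpDl.
have e1 : 0 < e / 2 / D by rewrite !divr_gt0.
have [r1 r10 H1] := continuous_enorm cn e1.
have [r2 r20 H2] := nbhs_enorm near_x.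
(* [delta x / 4] makes [dist_le_linear] applicable in both directions and keeps [delta y] above
   [delta x / 2]; the last bound absorbs the quadratic terms. *)
have r30 : 0 < Num.min (Num.min r1 r2) (Num.min (delta x / 4) (e * delta x / 4 / D)).
  by rewrite !lt_min r10 r20 !divr_gt0// mulr_gt0.
apply: (enorm_nbhs r30) => y; rewrite !lt_min => /andP[/andP[y1 y2] /andP[y3 y4]].
have [Ty /andP[dy _] Uy yE] := H2 y y2.
have nn := H1 y y1; rewrite /= in nn.
have dyx := tube_dist_lip proj Tx Ty; have dxy := tube_dist_lip proj Ty Tx.
rewrite (enormB x y) in dxy.
have A := dist_le_linear Tx Ty dx Ux xE (ltac:(lra)).
have B := dist_le_linear Ty Tx dy Uy yE (ltac:(rewrite (enormB x y); lra)).
rewrite (enormB x y) in B.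
have Bn : dotp (x - y) (n (p y)) = - dotp (y - x) (n (p x)) - dotp (y - x) (n (p y) - n (p x)).
  have -> : x - y = - (y - x) by vec.
  by rewrite dotpNl dotpDr dotpNr; ring.
have C : dotp (y - x) (n (p y) - n (p x)) >= - (enorm (y - x) * (e / 2 / D)).
  rewrite lerNl -dotpNr; apply: le_trans (cauchy_schwarz _ _) _.
  by rewrite enormN ler_wpM2l ?enorm_ge0// ltW.
have q z : delta x / 2 <= z -> enorm (y - x) ^+ 2 / z <= enorm (y - x) * (e / 2 / D).
  move=> hz; have z0 : 0 < z by lra.
  rewrite expr2 -mulrA ler_wpM2l ?enorm_ge0// ler_pdivrMr//.
  apply: le_trans (ltW y4) _.
  have -> : e * delta x / 4 / D = e / 2 / D * (delta x / 2) by field; rewrite gt_eqF.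
  by rewrite ler_pM2l.
have qx := q (delta x) (ltac:(lra)); have qy := q (delta y) (ltac:(lra)).
have De : enorm (y - x) * (e / D) <= e * `|y - x|.
  have : enorm (y - x) <= D * `|y - x|.
    by apply: le_trans (enorm_le_mx_norm _) _; rewrite ler_wpM2r// lerDl.
  move=> hD; have := ler_wpM2l (ltW (divr_gt0 e0 D0)) hD.
  have -> : e / D * (D * `|y - x|) = e * `|y - x| by field; rewrite gt_eqF.
  by rewrite mulrC.
have De' : enorm (y - x) * (e / 2 / D) + enorm (y - x) * (e / 2 / D) = enorm (y - x) * (e / D).
  by field; rewrite gt_eqF.
have E0 : 0 <= enorm (y - x) * (e / 2 / D) by rewrite mulr_ge0 ?enorm_ge0 ?ltW.
rewrite (dotpC (n (p x))); apply: le_trans De; rewrite ler_norml; apply/andP; split; lra.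
Unshelve. all: by end_near. Qed.

Lemma dist_continuous : {for x0, continuous (fun x : V => delta x)}.
Proof.
apply: (tder_continuous _ (nbhs_singleton dist_tder) (norm_dotp_sup _)).
by rewrite mulr_ge0// exprn_ge0.
Qed.

Lemma norm_normal_le x : U (p x) -> `|n (p x)| <= 1.
Proof.
by move=> Ux; have [[_ _ n1 _ _] _ _] := oeq; rewrite -(n1 _ Ux) mx_norm_le_enorm.
Qed.

(** Differencing [x = p x + delta x *: n (p x)] gives the relation of [implicit_C1at], with [N x]
    the orthogonal projection onto the tangent space. Invertibility of [M x] is [normal_map_inj]
    below the reach [eps / 2]; the constant [2 * d] is the Euclidean Lipschitz constant 2 converted
    to the sup norm. *)
Lemma projection_C1at : C1at p x0 /\ (\forall x \near x0, `|jac p x| <= 2 * d%:R).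
Proof.
have [leq Up0 _] := oeq; have [oU Cn n1 _ Th] := leq; have [eps0 pin _ _] := proj.
have [Tx0 _ _ _] := nbhs_singleton oeq_near.
have cp := projection_continuous proj Tx0.
apply: (@implicit_C1at _ _ p (fun x => 1%:M + delta x *: jac n (p x))
  (fun x => 1%:M - (n (p x))^T *m n (p x))).
- by rewrite mulr_ge0.
- apply: filterS2 oeq_near oeq_near2 => x [Tx /andP[_ dx] _ _].
  apply: filterS => y [Ty /andP[_ dy] _ _].
  apply: le_trans (mx_norm_le_enorm _) _; apply: le_trans (projection_lip proj Ty Tx dy dx) _.
  by rewrite -mulrA ler_pM2l// enorm_le_mx_norm.
- apply: continuous_mx => i j.
  apply: (@eq_continuous_for _ _ _ (fun x => (1%:M : 'M[R]_d) i j + delta x * jac n (p x) i j)).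
    by move=> x; rewrite !mxE.
  apply: continuousD; first exact: cst_continuous.
  apply: continuousM; first exact: dist_continuous.
  apply: (@continuous_comp _ _ _ p (fun y => jac n y i j)) => //.
  by apply: continuous_coord; exact: (Ck_on_jac_continuous (Ck_on_le _ Cn)).
- have cnp := nbhs_singleton normal_projection_continuous.
  apply: continuous_mx => i j.
  apply: (@eq_continuous_for _ _ _ (fun x => (1%:M : 'M[R]_d) i j - n (p x) 0 i * n (p x) 0 j)).
    by move=> x; rewrite !mxE big_ord1 !mxE.
  apply: continuousB; first exact: cst_continuous.
  by apply: continuousM; apply: (@continuous_coord _ _ _ _ (fun x : V => n (p x))); exact: cnp.
- apply: filterS oeq_near => x [Tx /andP[dx dx4] Ux xE].
  apply: unitmx_inj => v; rewrite mulmxDr mulmx1 -scalemxAr => vker.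
  apply: (normal_map_inj (s := delta x) (t := eps / 2) leq Ux (pin _ Tx) _ _ vker).
    by rewrite dx; move: eps0; lra.
  move=> eta He; have := prox_regular proj (t := eps / 2) Tx He (ltac:(apply/andP; split; move: eps0; lra)).
  by rewrite {1}xE dotpZl mulrCA ler_pM2l.
near=> x; have [Tx /andP[dx dx4] Ux xE] : [/\ T x, 0 < delta x <= eps / 4, U (p x) & x - p x = delta x *: n (p x)].
  by near: x; exact: oeq_near.
have near_x : \forall y \near x,
    [/\ T y, 0 < delta y <= eps / 4, U (p y) & y - p y = delta y *: n (p y)].
  by near: x; exact: oeq_near2.
have cn : {for x, continuous (n \o p)} by near: x; exact: normal_projection_continuous.
have dt : tder (fun x : V => delta x) x (fun u => dotp (n (p x)) u) by near: x; exact: dist_tder.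
have cpx := projection_continuous proj Tx.
move=> e e0; have tn := normal_tder leq Ux.
have e1 : 0 < e / 3 / (delta x * (2 * d%:R) + 1) by rewrite !divr_gt0// ltr_wpDl// !mulr_ge0// ltW.
have e2 : 0 < e / 3 by rewrite divr_gt0.
have e3 : 0 < e / 3 / (d%:R + 1) by rewrite !divr_gt0// ltr_wpDl.
near=> y.
have [Ty /andP[dy dy4] Uy yE] : [/\ T y, 0 < delta y <= eps / 4, U (p y) & y - p y = delta y *: n (p y)].
  by near: y.
have b1 : `|n (p y) - n (p x) - (p y - p x) *m jac n (p x)| <=
    e / 3 / (delta x * (2 * d%:R) + 1) * `|p y - p x|.
  near: y; exact: (cpx _ (tn _ e1)).
have b2 : `|delta y - delta x - dotp (n (p x)) (y - x)| <= e / 3 * `|y - x| by near: y; exact: dt.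
have b3 : `|n (p y) - n (p x)| <= e / 3 / (d%:R + 1).
  by near: y; exact: ((continuous_distP _ _).1 cn _ e3).
have lip : `|p y - p x| <= 2 * d%:R * `|y - x|.
  apply: le_trans (mx_norm_le_enorm _) _; apply: le_trans (projection_lip proj Ty Tx dy4 dx4) _.
  by rewrite -mulrA ler_pM2l// enorm_le_mx_norm.
have dlip : `|delta y - delta x| <= d%:R * `|y - x|.
  apply: le_trans (enorm_le_mx_norm _).
  have := tube_dist_lip proj Tx Ty; have := tube_dist_lip proj Ty Tx.
  by rewrite (enormB x y) ler_distl; lra.
(* The three errors: the first-order remainder of [n] at [p x], that of the distance, and a product
   of two increments. *)
have -> : (p y - p x) *m (1%:M + delta x *: jac n (p x)) - (y - x) *m (1%:M - (n (p x))^T *m n (p x)) =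
    - (delta x *: (n (p y) - n (p x) - (p y - p x) *m jac n (p x)))
    + - ((delta y - delta x - dotp (n (p x)) (y - x)) *: n (p x))
    + - ((delta y - delta x) *: (n (p y) - n (p x))).
  rewrite mulmxDr mulmxBr !mulmx1 -scalemxAr mulmxA.
  have -> : (y - x) *m (n (p x))^T = (dotp (n (p x)) (y - x))%:M.
    rewrite [LHS]mx11_scalar; congr (_%:M); rewrite mxE dotpC.
    by apply: eq_bigr => i _; rewrite !mxE.
  rewrite mul_scalar_mx; move: (_ *m jac n (p x)) => wJ; move: (dotp _ (y - x)) => A.
  have -> : y - x = (p y - p x) + delta y *: n (p y) - delta x *: n (p x).
    by rewrite -yE -xE; vec.
  by vec.
have -> : e * `|y - x| = e / 3 * `|y - x| + e / 3 * `|y - x| + e / 3 * `|y - x| by field.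
apply: le_trans (ler_normD _ _) (lerD _ _); first apply: le_trans (ler_normD _ _) (lerD _ _).
- rewrite normrN normrZ (gtr0_norm dx).
  apply: le_trans (ler_wpM2l (ltW dx) b1) _.
  have : e / 3 / (delta x * (2 * d%:R) + 1) * `|p y - p x| <= e / 3 / (delta x * (2 * d%:R) + 1) * (2 * d%:R * `|y - x|).
    by rewrite ler_pM2l.
  move=> /(ler_wpM2l (ltW dx)) /le_trans; apply.
  rewrite [leLHS](_ : _ = e / 3 / (delta x * (2 * d%:R) + 1) * (delta x * (2 * d%:R)) * `|y - x|); last by ring.
  by rewrite ler_wpM2r// ler_div1p ?(ltW e2)// !mulr_ge0// ltW.
- rewrite normrN normrZ; apply: le_trans b2; rewrite ler_piMr//.
  exact: norm_normal_le.
- rewrite normrN normrZ; apply: le_trans (ler_pM _ _ dlip b3) _ => //.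
  rewrite (_ : d%:R * `|y - x| * _ = e / 3 / (d%:R + 1) * d%:R * `|y - x|); last by ring.
  by rewrite ler_wpM2r// ler_div1p// ltW.
Unshelve. all: by end_near. Qed.

End OffTheta.
End ProjectionC1.

(** * Admissible local normal fields and the extension of alpha *)

Section NormalField.
Context {R : realType} {d : nat}.
Local Notation V := 'rV[R]_d.
Context (Theta : set V) (eps : R) (p : V -> V).
Hypothesis proj : nearest_projection Theta eps p.

(* Segments issued from [xi] are mapped by [p] into [Theta], so nearby points of [Theta] lie in the component of [xi]. *)
Lemma component_near (U : set V) (xi0 xi : V) : open U -> connected_component (Theta `&` U) xi0 xi ->
  \forall eta \near xi, Theta eta -> connected_component (Theta `&` U) xi0 eta.
Proof.
move=> oU Bxi; have [Txi Uxi] := connected_component_sub Bxi; have [_ pin _ _] := proj.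
have tubexi := sub_tube proj Txi.
have pxi := projection_id proj Txi.
have pU : \forall y \near xi, U (p y).
  by apply: (projection_continuous proj tubexi); rewrite pxi; exact: open_nbhs_nbhs.
have [r r0 Hr] : exists2 r : R, 0 < r & forall y, enorm (y - xi) < r -> tube Theta eps y /\ U (p y).
  by apply: nbhs_enorm; apply: filterS2 (tube_near proj tubexi) pU => y.
apply: (enorm_nbhs r0) => eta etar Teta.
pose g (t : R) := p (xi + t *: (eta - xi)).
have seg t : 0 <= t <= 1 -> enorm (xi + t *: (eta - xi) - xi) < r.
  move=> /andP[t0 t1]; rewrite addrC addKr enormZ ger0_norm//.
  by apply: le_lt_trans etar; rewrite ler_piMl// enorm_ge0.
have cg : connected (g @` `[0, 1]).
  apply: connected_continuous_connected; first exact: segment_connected.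
  apply: continuous_in_subspaceT => t; rewrite inE /= in_itv /= => /seg/Hr[Ty _].
  apply: (@continuous_comp _ _ _ (fun t : R => xi + t *: (eta - xi)) p).
    by apply: continuousD; [exact: cst_continuous|exact: scalel_continuous].
  exact: projection_continuous Ty.
apply: (connected_component_trans Bxi).
apply: (connected_component_max _ _ cg).
- by exists 0; [rewrite /= in_itv /= lexx ler01|rewrite /g scale0r addr0].
- move=> _ [t t01 <-]; move: t01; rewrite /= in_itv /= => /seg/Hr[Ty Uy].
  by split=> //; exact: pin.
- exists 1; first by rewrite /= in_itv /= lexx ler01.
  by rewrite /g scale1r subrKC; exact: (projection_id proj Teta).
Qed.

(** The regularity assumption on alpha concerns connected, relatively open pieces of [Theta]; the
    component of [xi] in [U] is one, and [component_near] gives its openness. *)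
Lemma local_normal_field_exists U h n lam (xi : V) : local_equation Theta U h n lam -> U xi -> Theta xi ->
  exists B : set V, [/\ local_normal_field Theta B n, B xi & \forall eta \near xi, Theta eta -> B eta].
Proof.
move=> leq Uxi Txi; have [oU Cn _ _ _] := leq.
pose B := connected_component (Theta `&` U) xi.
have Bxi : B xi by apply: connected_component_refl.
exists B; split=> //; last exact: component_near Bxi.
split.
- by move=> x /connected_component_sub[].
(* The complement of [Theta] is added so that the interior is taken in the whole space; the trace on
   [Theta] is again [B]. *)
- exists ((B `|` ~` Theta)°); split; first exact: open_interior.
  apply/seteqP; split=> [x Bx|x [Tx /interior_subset[]//]].
  split; first by have [] := connected_component_sub Bx.
  by apply: filterS (component_near oU Bx) => y By; have [/By|] := pselect (Theta y); [left|right].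
- exact: component_connected.
- by move=> x /connected_component_sub[_ Ux]; exists U, n.
- by move=> x /connected_component_sub[Tx Ux]; exact: (local_equation_unit_normal leq).
Qed.

(** The bounds by [a] hold only at points of [Theta], which suffices because [F] is evaluated at
    foot points. The empty index list bounds [F], the singletons bound the rows of its Jacobian. *)
Lemma alpha_extension mu sigma (a : R) U h n lam (xi : V) :
  alpha_regular mu sigma Theta a -> local_equation Theta U h n lam -> U xi -> Theta xi ->
  exists F : V -> V, C1at F xi /\ \forall eta \near xi, Theta eta ->
    [/\ F eta = alpha_at mu sigma eta (n eta), enorm (F eta) <= a & `|jac F eta| <= a].
Proof.
move=> areg leq Uxi Txi.
have [B [lnf Bxi Bnear]] := local_normal_field_exists leq Uxi Txi.
have [_ /(_ xi Bxi)[W [F [Wxi CF FE Fa]]]] := areg B n lnf.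
have CF1 : Ck_on 1 W F by exact: Ck_on_le CF.
have oW := CF.1.
have Wn : \forall y \near xi, W y by exact: open_nbhs_nbhs.
have a0 : 0 <= a by apply: le_trans (Fa [::] isT xi Wxi Bxi); exact: enorm_ge0.
exists F; split.
  split; last exact: (Ck_on_jac_continuous CF1).
  by apply: filterS Wn => y Wy; exact: (Ck_on_tder CF1).
apply: filterS2 Wn Bnear => eta Weta Beta /Beta{}Beta; split.
- exact: FE.
- exact: (Fa [::] isT eta).
apply: mx_norm_le => // i j; rewrite mxE.
apply: le_trans (Fa [:: i] isT eta Weta Beta).
exact: le_trans (coord_le_norm _ _ _) (mx_norm_le_enorm _).
Qed.

End NormalField.

Lemma lip_continuous {R : realType} {V W : normedModType R} (f : V -> W) (K : R) :
  0 <= K -> (forall x y, `|f y - f x| <= K * `|y - x|) -> continuous f.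
Proof. by move=> K0 fK x; apply: (near_lip_continuous K0); exact: nearW. Qed.

(** * The transformation G *)

Section RadialProfile.
Context {R : realType}.
Implicit Types (c s t : R).

Let pos t : R := Num.max 0 t.

Lemma pos_ge0 t : 0 <= pos t. Proof. by rewrite /pos le_max lexx. Qed.

Lemma pos_lip s t : `|pos s - pos t| <= `|s - t|.
Proof.
rewrite /pos; case: (ltP 0 s) => hs; case: (ltP 0 t) => ht.
- by [].
- by rewrite subr0 gtr0_norm// ger0_norm; lra.
- by rewrite sub0r normrN gtr0_norm// ler0_norm; lra.
- by rewrite subrr normr0.
Qed.

Lemma pos_continuous : continuous pos.
Proof.
by apply: (@lip_continuous _ _ _ pos 1) => // s t; rewrite mul1r pos_lip.
Qed.

(** The cube of the positive part is C^1 across 0; the remainder is quadratic in each of the four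
    sign cases. *)
Lemma pos_cube_tder t : tder (fun s => pos s ^+ 3) t (fun u => u * (3 * pos t ^+ 2)).
Proof.
apply: (@tder_quadratic _ _ _ _ _ _ (3 + 3 * pos t)).
  by rewrite !addr_ge0// mulr_ge0// pos_ge0.
have n1 : \forall y \near t, `|y - t| <= 1 by exact: near_norm_le.
apply: filterS n1 => s s1.
have /andP[hl1 hl2] : - 1 <= s - t <= 1 by rewrite -ler_norml.
rewrite -normrX (ger0_norm (sqr_ge0 _)).
have sq : 0 <= (s - t) ^+ 2 by exact: sqr_ge0.
rewrite /pos; case: (ltP 0 s) => hs; case: (ltP 0 t) => ht.
- have -> : s ^+ 3 - t ^+ 3 - (s - t) * (3 * t ^+ 2) = (s - t) ^+ 2 * ((s - t) + 3 * t) by ring.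
  rewrite normrM (ger0_norm sq) mulrC ler_wpM2r//; apply: le_trans (ler_normD _ _) _.
  by rewrite (ger0_norm (_ : 0 <= 3 * t)); lra.
- have -> : s ^+ 3 - 0 ^+ 3 - (s - t) * (3 * 0 ^+ 2) = s ^+ 2 * s by ring.
  rewrite ger0_norm ?mulr_ge0 ?sqr_ge0 ?(ltW hs)// mulr0 addr0.
  have h1 : s ^+ 2 * s <= s ^+ 2 * 1 by rewrite ler_wpM2l ?sqr_ge0//; lra.
  have h2 : s ^+ 2 <= (s - t) ^+ 2 by rewrite lerXn2r ?nnegrE; lra.
  lra.
- have -> : 0 ^+ 3 - t ^+ 3 - (s - t) * (3 * t ^+ 2) = t ^+ 2 * (2 * t - 3 * s) by ring.
  have t2 : t ^+ 2 <= (s - t) ^+ 2 by rewrite -[leRHS]sqrrN lerXn2r ?nnegrE; lra.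
  rewrite ger0_norm; last by rewrite mulr_ge0 ?sqr_ge0//; lra.
  by rewrite mulrC ler_pM ?sqr_ge0//; lra.
- by rewrite !expr0n /= !(mulr0, subr0, addr0) normr0 mulr_ge0.
Qed.

(** This is [s ^+ 2 * phi (s / c)]: since [(1 + u)^3 (1 - u)^3 = (1 - u^2)^3], the cut-off is the
    cube of a positive part and needs no case split. *)
Definition profile c s : R := s ^+ 2 * Num.max 0 (1 - (s / c) ^+ 2) ^+ 3.

Definition profile' c s : R := s ^+ 2 * (- (2 * s / c ^+ 2) * (3 * Num.max 0 (1 - (s / c) ^+ 2) ^+ 2))
  + Num.max 0 (1 - (s / c) ^+ 2) ^+ 3 * (2 * s).

Lemma profile_tder c s : 0 < c -> tder (profile c) s (fun u => u * profile' c s).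
Proof.
move=> c0; have cn0 : c != 0 by rewrite gt_eqF.
pose v t : R := 1 - (t / c) ^+ 2.
have tv : tder v s (fun u => u * (- (2 * s / c ^+ 2))).
  apply: (@tder_quadratic_all _ _ _ _ _ _ (c^-1 ^+ 2)) => [|t]; first exact: sqr_ge0.
  rewrite -normrX.
  have -> : v t - v s - (t - s) * - (2 * s / c ^+ 2) = - (c^-1 ^+ 2 * (t - s) ^+ 2).
    by rewrite /v; field.
  by rewrite normrN normrM (ger0_norm (sqr_ge0 c^-1)).
have ts : tder (fun t : R => t ^+ 2) s (fun u => u * (2 * s)).
  apply: (@tder_quadratic_all _ _ _ _ _ _ 1) => // t.
  by rewrite -normrX mul1r (_ : t ^+ 2 - s ^+ 2 - _ = (t - s) ^+ 2)//; ring.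
have tp := tder_comp (normr_ge0 (- (2 * s / c ^+ 2))) (normr_ge0 (3 * pos (v s) ^+ 2)) tv (pos_cube_tder (v s)).
have {}tp := tp (fun u => ltac:(by rewrite normrM mulrC)) (fun u => ltac:(by rewrite normrM mulrC))
  (fun u w => mulrDl _ _ _).
have lin (k : R) (a b : R) : (a *: b) * k = a *: (b * k) by rewrite -[a *: b]/(a * b) -[RHS]/(a * (b * k)) mulrA.
have d1 : is_derive (s : R) (1 : R) (fun t : R => t ^+ 2) (1 * (2 * s)).
  by apply: (tder_is_derive _ ts) => a b; exact: lin.
have d2 : is_derive (s : R) (1 : R) ((fun s => pos s ^+ 3) \o v)
    (1 * (- (2 * s / c ^+ 2)) * (3 * pos (v s) ^+ 2)).
  have tp' : tder ((fun s => pos s ^+ 3) \o v) s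
      (fun u : R => u * (- (2 * s / c ^+ 2)) * (3 * pos (v s) ^+ 2)) by exact: tp.
  by apply: (tder_is_derive _ tp') => a b; rewrite -[a *: b]/(a * b) -[RHS]/(a * _) !mulrA.
have [d3 d3E] := is_deriveM d1 d2.
have := derivable_tder d3; rewrite d3E; apply: tder_eq => u.
by rewrite -[_ *: _]/(u * _) /profile' /= -/(pos _) -![_ *: (_ * _)]/(_ * _); congr (_ * _); rewrite !mul1r.
Qed.

Lemma profile'_continuous c : 0 < c -> continuous (profile' c).
Proof.
move=> c0 s.
have cid : {for s, continuous (fun t : R => t)} by exact: cvg_id.
have cv : {for s, continuous (fun t : R => 1 - (t / c) ^+ 2)}.
  apply: continuousB; first exact: cst_continuous.
  by apply: continuousM; apply: continuousM => //; exact: cst_continuous.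
have cp : {for s, continuous (fun t : R => pos (1 - (t / c) ^+ 2))}.
  by apply: continuous_comp cv _; exact: pos_continuous.
apply: (@eq_continuous_for _ _ _ (fun t : R =>
  t ^+ 2 * (- (2 * t / c ^+ 2) * (3 * pos (1 - (t / c) ^+ 2) ^+ 2)) +
  pos (1 - (t / c) ^+ 2) ^+ 3 * (2 * t))) => //.
apply: continuousD; apply: continuousM.
- by apply: continuousM.
- apply: continuousM.
    by apply: continuousN; apply: continuousM; [apply: continuousM => //|]; exact: cst_continuous.
  by apply: continuousM; [exact: cst_continuous|apply: continuousM].
- by apply: continuousM => //; apply: continuousM.
- by apply: continuousM => //; exact: cst_continuous.
Qed.

Lemma profile_out c s : 0 < c -> c <= s -> profile c s = 0 /\ profile' c s = 0.
Proof.
move=> c0 cs; have v0 : 1 - (s / c) ^+ 2 <= 0.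
  rewrite subr_le0 -[leLHS](expr1n _ 2) lerXn2r ?nnegrE ?divr_ge0 ?(ltW c0)//.
    exact: le_trans (ltW c0) cs.
  by rewrite ler_pdivlMr// mul1r.
by rewrite /profile /profile' (max_l v0) !expr0n /= !(mulr0, mul0r, addr0).
Qed.

(** The bounds do not depend on [c]; restricted to [s < c] they are what makes the perturbation
    small with [c]. *)
Lemma profile_bounds c s : 0 < c -> 0 <= s ->
  `|profile c s| <= s ^+ 2 /\ `|profile' c s| <= 8 * s.
Proof.
move=> c0 s0; have [cs|sc] := leP c s.
  have [-> ->] := profile_out c0 cs.
  by rewrite normr0 sqr_ge0 mulr_ge0.
have sc1 : s / c <= 1 by rewrite ler_pdivrMr// mul1r ltW.
have sc0 : 0 <= s / c by rewrite divr_ge0// ltW.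
have q1 : (s / c) ^+ 2 <= 1 by rewrite expr_le1.
have q0 : 0 <= (s / c) ^+ 2 by rewrite sqr_ge0.
rewrite /profile /profile'; set P := Num.max 0 _.
have P0 : 0 <= P by exact: pos_ge0.
have P1 : P <= 1 by rewrite /P ge_max ler01 /= lerBlDr lerDl.
have P3 : P ^+ 3 <= 1 by rewrite exprn_ile1.
have P2 : P ^+ 2 <= 1 by rewrite exprn_ile1.
split.
  by rewrite ger0_norm ?mulr_ge0 ?sqr_ge0 ?exprn_ge0// ler_piMr ?sqr_ge0.
(* The factor next to [2 * s] is at most 4 in absolute value, since [P] and [s / c] lie between 0
   and 1; hence the constant 8. *)
have -> : s ^+ 2 * (- (2 * s / c ^+ 2) * (3 * P ^+ 2)) + P ^+ 3 * (2 * s) =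
    (2 * s) * (P ^+ 3 - 3 * ((s / c) ^+ 2 * P ^+ 2)) by field; rewrite gt_eqF.
rewrite normrM ger0_norm ?mulr_ge0//.
have z1 : (s / c) ^+ 2 * P ^+ 2 <= 1 by rewrite mulr_ile1 ?sqr_ge0.
have z0 : 0 <= (s / c) ^+ 2 * P ^+ 2 by rewrite mulr_ge0 ?sqr_ge0.
have : 0 <= P ^+ 3 by rewrite exprn_ge0.
move=> P30; have : `|P ^+ 3 - 3 * ((s / c) ^+ 2 * P ^+ 2)| <= 4 by rewrite ler_norml; lra.
move=> /(ler_wpM2l (mulr_ge0 (ler0n R 2) s0)); lra.
Qed.

Lemma profile_phi c s : 0 < c -> 0 <= s -> s * s * phi (s / c) = profile c s.
Proof.
move=> c0 s0; have sc0 : 0 <= s / c by rewrite divr_ge0// ltW.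
rewrite -expr2 /phi /profile ger0_norm//; case: ifP => [sc1|/negbT]; last first.
  rewrite -ltNge => sc1; rewrite max_l ?expr0n//= subr_le0 ltW//.
  by rewrite -[ltLHS](expr1n _ 2) ltrXn2r// nnegrE.
rewrite max_r; first by ring.
by rewrite subr_ge0 expr_le1.
Qed.

End RadialProfile.

(** * Differentiability of G and bounds on its Jacobian *)

Section Transformation.
Context {R : realType} {d : nat}.
Local Notation V := 'rV[R]_d.
Context (mu : V -> V) (sigma : V -> 'M[R]_d) (Theta : set V) (eps a c : R) (p G : V -> V).
Hypothesis proj : nearest_projection Theta eps p.
Hypothesis hyp : hypersurface 3 Theta.
Hypothesis areg : alpha_regular mu sigma Theta a.
Hypothesis c0 : 0 < c.
Hypothesis c1 : c <= 1.
Hypothesis ceps : c < eps / 4.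
Hypothesis Gtube : forall x v, tube Theta eps x -> unit_normal Theta (p x) v ->
  G x = x + phitilde p c v x *: alpha_at mu sigma (p x) v.
Hypothesis Gout : forall x, ~ tube Theta eps x -> G x = x.
Local Notation T := (tube Theta eps).
Local Notation delta x := (enorm (x - p x)).

(** [8 * |a|] bounds the term with the derivative of the profile. The other term carries the
    Jacobians of [p] and [F]: [2 * d] for [p], [a] for [F], and one more [d] from the sup norm of a
    matrix product. *)
Definition jac_const : R := 8 * `|a| + 2 * d%:R ^+ 2 * `|a|.

Let C0 : 0 <= jac_const.
Proof. by rewrite addr_ge0// !mulr_ge0// exprn_ge0. Qed.

Lemma G_far x : T x -> c <= delta x -> G x = x.
Proof.
move=> Tx cx; have [_ pin _ _] := proj.
have [U [h [n [lam [Up leq]]]]] := local_equation_exists hyp (pin _ Tx).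
rewrite (Gtube Tx (local_equation_unit_normal leq Up (pin _ Tx))) /phitilde.
suff -> : phi (delta x / c) = 0 by rewrite mulr0 scale0r addr0.
have d0 : delta x != 0 by rewrite gt_eqF// (lt_le_trans c0).
have := profile_phi c0 (enorm_ge0 (x - p x)); rewrite (profile_out c0 cx).1.
by move=> /eqP; rewrite mulf_eq0 mulf_eq0 orbb (negbTE d0) /= => /eqP.
Qed.

(** The inner product and the norm in [phitilde] each contribute a factor [delta x], and the values
    of [phi] met here lie between 0 and 1. Only boundedness of alpha is used, so the estimate is
    available on [Theta] itself. *)
Lemma G_near_id x : T x -> enorm (G x - x) <= `|a| * delta x ^+ 2.
Proof.
move=> Tx; have [_ pin _ _] := proj.
have [U [h [n [lam [Up leq]]]]] := local_equation_exists hyp (pin _ Tx).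
have [F [_ Fnear]] := alpha_extension proj areg leq Up (pin _ Tx).
have [Fp Fa _] := nbhs_singleton Fnear (pin _ Tx).
have un := local_equation_unit_normal leq Up (pin _ Tx).
rewrite (Gtube Tx un) -Fp addrC addKr enormZ mulrC.
apply: ler_pM; rewrite ?normr_ge0 ?enorm_ge0//; first exact: le_trans (ler_norm _).
have [n1 _] := un; have dn := norm_dotp (x - p x) (n (p x)); rewrite n1 mulr1 in dn.
rewrite /phitilde !normrM (ger0_norm (enorm_ge0 _)) expr2 -mulrA.
apply: ler_pM => //; first by rewrite mulr_ge0 ?enorm_ge0.
rewrite ler_piMr ?enorm_ge0//.
have s0 : 0 <= delta x / c by rewrite divr_ge0 ?enorm_ge0 ?ltW.
rewrite /phi (ger0_norm s0); case: ifP => [s1|]; last by rewrite normr0.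
have -> : (1 + delta x / c) ^+ 3 * (1 - delta x / c) ^+ 3 = (1 - (delta x / c) ^+ 2) ^+ 3 by ring.
have q0 : 0 <= (delta x / c) ^+ 2 by rewrite exprn_ge0.
have q1 : (delta x / c) ^+ 2 <= 1 by rewrite expr_le1.
by rewrite ger0_norm ?exprn_ge0 ?exprn_ile1//; lra.
Qed.

(** The outward normal turns [phitilde] into [profile c (delta x)], so near [x0] the map is the
    identity plus [profile c (delta x) *: F (p x)]; the chain and product rules give its
    Jacobian. *)
Lemma G_off_Theta x0 : T x0 -> 0 < delta x0 -> delta x0 < eps / 4 ->
  C1at G x0 /\ (\forall x \near x0, `|jac G x - 1%:M| <= jac_const * delta x /\
    `|jac G x - 1%:M| <= jac_const * c).
Proof.
move=> Tx0 dx0 dx4; have [_ pin _ _] := proj.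
have [U [h [n [lam oeq]]]] := outward_equation_exists proj hyp Tx0 dx0.
have [leq Up0 onear] := oeq; have [_ Cn n1 _ _] := leq.
have [F [CF Fnear]] := alpha_extension proj areg leq Up0 (pin _ Tx0).
have cp := projection_continuous proj Tx0.
have dt := dist_tder proj oeq dx4.
have [Cp pbound] := projection_C1at proj oeq dx4.
have Fp : \forall x \near x0, Theta (p x) ->
    [/\ F (p x) = alpha_at mu sigma (p x) (n (p x)), enorm (F (p x)) <= a & `|jac F (p x)| <= a].
  exact: (cp _ Fnear).
have tF : \forall x \near x0, tder F (p x) (fun u => u *m jac F (p x))
  by exact: (cp [set y | tder F y (fun u => u *m jac F y)] CF.1).
have all1 : \forall x \near x0, [/\ T x, 0 < delta x, U (p x), x - p x = delta x *: n (p x) &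
    [/\ F (p x) = alpha_at mu sigma (p x) (n (p x)), enorm (F (p x)) <= a & `|jac F (p x)| <= a]].
  by apply: filterS2 onear Fp => x [Tx dx Ux xE] /(_ (pin _ Tx)).
have GE : \forall x \near x0, x + profile c (delta x) *: F (p x) = G x.
  apply: filterS all1 => x [Tx dx Ux xE [FE _ _]].
  rewrite (Gtube Tx (local_equation_unit_normal leq Ux (pin _ Tx))) -FE /phitilde.
  by rewrite {2}xE dotpZl -sqr_enorm n1// expr1n mulr1 profile_phi// enorm_ge0.
pose Jg x : 'M[R]_d := profile' c (delta x) *: ((n (p x))^T *m F (p x)) +
  profile c (delta x) *: (jac p x *m jac F (p x)).
have tJ : \forall x \near x0, tder G x (fun u => u *m (1%:M + Jg x)).
  near=> x.
  have dtx : tder (fun x : V => delta x) x (fun u => dotp (n (p x)) u) by near: x; exact: dt.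
  have tpx : tder p x (fun u => u *m jac p x) by near: x; exact: Cp.1.
  have tFx : tder F (p x) (fun u => u *m jac F (p x)) by near: x; exact: tF.
  have GEx : \forall y \near x, y + profile c (delta y) *: F (p y) = G y.
    by near: x; exact: nbhs_interior GE.
  apply: (tder_near_eq GEx).
  have K1 : 0 <= d%:R ^+ 2 * `|n (p x)| by rewrite mulr_ge0// exprn_ge0.
  have K2 : 0 <= d%:R * `|jac p x| by rewrite mulr_ge0.
  have K3 : 0 <= d%:R * `|jac F (p x)| by rewrite mulr_ge0.
  have prof : tder (fun x : V => profile c (delta x)) x (fun u => dotp (n (p x)) u * profile' c (delta x)).
    apply: (tder_comp K1 (normr_ge0 (profile' c (delta x))) dtx (profile_tder _ c0) (norm_dotp_sup _)).
      by move=> u; rewrite normrM mulrC.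
    by move=> u v; rewrite mulrDl.
  have Fpt : tder (fun x : V => F (p x)) x (fun u => u *m jac p x *m jac F (p x)).
    apply: (tder_comp K2 K3 tpx tFx (norm_mulmx_rV _) (norm_mulmx_rV _)).
    by move=> u v; rewrite mulmxDl.
  have gt := tder_scale (mulr_ge0 K1 (normr_ge0 (profile' c (delta x)))) (mulr_ge0 K3 K2) prof Fpt.
  have b1 (u : V) : `|dotp (n (p x)) u * profile' c (delta x)| <=
      d%:R ^+ 2 * `|n (p x)| * `|profile' c (delta x)| * `|u|.
    by rewrite normrM mulrAC ler_wpM2r// norm_dotp_sup.
  have b2 (u : V) : `|u *m jac p x *m jac F (p x)| <= d%:R * `|jac F (p x)| * (d%:R * `|jac p x|) * `|u|.
    apply: le_trans (norm_mulmx_rV _ _) _; rewrite -[leRHS]mulrA ler_wpM2l//.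
    exact: norm_mulmx_rV.
  move=> e e0; apply: filterS (gt b1 b2 e e0) => y; congr (`| _ | <= _).
  rewrite mulmxDr mulmx1 /Jg mulmxDr -!scalemxAr !mulmxA.
  have -> : (y - x) *m (n (p x))^T = (dotp (n (p x)) (y - x))%:M.
    rewrite [LHS]mx11_scalar; congr (_%:M); rewrite mxE dotpC.
    by apply: eq_bigr => i _; rewrite !mxE.
  rewrite mul_scalar_mx.
  move: ((y - x) *m jac p x *m jac F (p x)) => Z; by vec.
have cJ : {for x0, continuous (fun x => 1%:M + Jg x)}.
  have cd := dist_continuous proj oeq dx4.
  have cprof' : {for x0, continuous (fun x : V => profile' c (delta x))}.
    apply: (@continuous_comp _ _ _ (fun x : V => delta x) (profile' c)) => //.
    exact: profile'_continuous.
  have cprof : {for x0, continuous (fun x : V => profile c (delta x))}.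
    apply: (@continuous_comp _ _ _ (fun x : V => delta x) (profile c)) => //.
    apply: (tder_continuous (normr_ge0 (profile' c (delta x0))) (profile_tder (delta x0) c0)) => u.
    by rewrite normrM mulrC.
  have cnp : {for x0, continuous (fun x : V => n (p x))}.
    exact: (nbhs_singleton (normal_projection_continuous proj oeq dx4)).
  have cFp : {for x0, continuous (fun x : V => F (p x))}.
    by apply: (@continuous_comp _ _ _ p F) => //; exact: C1at_continuous.
  have cJF : {for x0, continuous (fun x : V => jac F (p x))}.
    by apply: (@continuous_comp _ _ _ p (jac F)) => //; exact: CF.2.
  apply: continuous_mx => i j.
  apply: (@eq_continuous_for _ _ _ (fun x : V => (1%:M : 'M[R]_d) i j +
      (profile' c (delta x) * (n (p x) 0 i * F (p x) 0 j) +
       profile c (delta x) * (jac p x *m jac F (p x)) i j))) => [x|].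
    have <- : ((n (p x))^T *m F (p x)) i j = n (p x) 0 i * F (p x) 0 j by rewrite mxE big_ord1 mxE.
    by rewrite /Jg; move: (_ *m F (p x)) (_ *m jac F (p x)) => A B; rewrite !mxE.
  apply: continuousD; first exact: cst_continuous.
  apply: continuousD; apply: continuousM => //.
    apply: continuousM.
      exact: (@continuous_coord _ _ _ _ (fun x : V => n (p x))).
    exact: (@continuous_coord _ _ _ _ (fun x : V => F (p x))).
  apply: (@continuous_coord _ _ _ _ (fun x : V => jac p x *m jac F (p x))).
  exact: (@continuous_mulmx _ _ _ _ _ (fun x : V => jac p x) (fun x : V => jac F (p x)) x0 Cp.2 cJF).
split; first exact: C1at_intro tJ cJ.
near=> x.
have -> : jac G x = 1%:M + Jg x by apply: tder_jac; near: x; exact: tJ.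
have -> : 1%:M + Jg x - 1%:M = Jg x by rewrite addrC addKr.
have [Tx dx Ux xE [_ Fa Ja]] : [/\ T x, 0 < delta x, U (p x), x - p x = delta x *: n (p x) &
    [/\ F (p x) = alpha_at mu sigma (p x) (n (p x)), enorm (F (p x)) <= a & `|jac F (p x)| <= a]].
  by near: x; exact: all1.
have pb : `|jac p x| <= 2 * d%:R by near: x; exact: pbound.
(* Beyond [c] the profile and its derivative vanish. Below [c] the bound by [delta x] implies the
   one by [c], and [delta x ^ 2 <= delta x] because [c <= 1]. *)
have [cx|xc] := leP c (delta x).
  rewrite /Jg; have [-> ->] := profile_out c0 cx.
  by rewrite !scale0r addr0 normr0; split; apply: mulr_ge0 => //; exact: ltW.
have [m1 m2] := profile_bounds c0 (ltW dx).
have a0 : 0 <= a by exact: le_trans (enorm_ge0 _) Fa.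
suff J1 : `|Jg x| <= jac_const * delta x.
  by split=> //; apply: le_trans J1 _; rewrite ler_wpM2l// ltW.
rewrite /jac_const (ger0_norm a0) mulrDl; apply: le_trans (ler_normD _ _) (lerD _ _).
  rewrite normrZ [leRHS]mulrAC; apply: ler_pM => //.
  apply: le_trans (norm_mulmx _ _) _; rewrite mul1r -[leRHS]mul1r; apply: ler_pM => //.
    apply: mx_norm_le => // i j; rewrite mxE.
    by apply: le_trans (coord_le_norm _ _ _) _; rewrite (norm_normal_le oeq).
  exact: le_trans (mx_norm_le_enorm _) Fa.
rewrite normrZ [leRHS]mulrC; apply: ler_pM => //.
  apply: le_trans m1 _; rewrite expr2 ler_piMr ?(ltW dx)//.
  by apply: le_trans c1; rewrite ltW.
apply: le_trans (norm_mulmx _ _) _.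
have -> : 2 * d%:R ^+ 2 * a = d%:R * (2 * d%:R * a) by ring.
by rewrite ler_wpM2l// ler_pM.
Unshelve. all: by end_near. Qed.

Lemma G_on_Theta x0 : Theta x0 -> tder G x0 (fun u => u *m 1%:M).
Proof.
move=> Tx0; have tx0 := sub_tube proj Tx0.
have G0 : G x0 = x0.
  have := G_near_id tx0; rewrite (projection_id proj Tx0) subrr enorm0 expr0n mulr0 => h.
  by apply/eqP; rewrite -subr_eq0; apply/eqP/enorm_eq0/eqP; rewrite eq_le h enorm_ge0.
apply: (@tder_quadratic _ _ _ _ _ _ (`|a| * d%:R ^+ 2)); first by rewrite mulr_ge0// exprn_ge0.
apply: filterS (tube_near proj tx0) => x Tx.
rewrite mulmx1 G0 (_ : G x - x0 - (x - x0) = G x - x); last by vec.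
apply: le_trans (mx_norm_le_enorm _) _; apply: le_trans (G_near_id Tx) _.
rewrite -mulrA ler_wpM2l// -exprMn lerXn2r ?nnegrE ?enorm_ge0 ?mulr_ge0//.
apply: le_trans (enorm_le_mx_norm _).
by have [_ _ pmin _] := proj; exact: pmin.
Qed.

Lemma C1at_identity_near x0 : (\forall x \near x0, G x = x) ->
  C1at G x0 /\ jac G x0 = 1%:M.
Proof.
move=> Gid; have t1 : \forall x \near x0, tder G x (fun u => u *m 1%:M).
  have idn : \forall x \near x0, \forall y \near x, y = G y.
    by apply: nbhs_interior; apply: filterS Gid => x ->.
  apply: filterS idn => x xid; apply: (tder_near_eq xid) => e e0.
  apply: (enorm_nbhs ltr01) => y _.
  by rewrite mulmx1 subrr normr0 mulr_ge0// ltW.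
split; first by apply: (C1at_intro t1); exact: cst_continuous.
exact: tder_jac (nbhs_singleton t1).
Qed.

(** Four regions: outside the tube, on [Theta], at positive distance below [eps / 4], and beyond. In
    the first and last [G] is the identity nearby because [c < eps / 4]. On [Theta], continuity of
    the Jacobian needs the bound at neighbouring points and is left to [G_C1at]. *)
Lemma G_jac x0 : [/\ tder G x0 (fun u => u *m jac G x0),
  `|jac G x0 - 1%:M| <= jac_const * c,
  T x0 -> delta x0 < eps / 4 -> `|jac G x0 - 1%:M| <= jac_const * delta x0 &
  ~ Theta x0 -> C1at G x0].
Proof.
have [eps0 pin pmin _] := proj.
have z s : 0 <= s -> `|1%:M - 1%:M : 'M[R]_d| <= jac_const * s.
  by move=> s0; rewrite subrr normr0 mulr_ge0.
have idcase : (\forall x \near x0, G x = x) -> [/\ tder G x0 (fun u => u *m jac G x0),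
    `|jac G x0 - 1%:M| <= jac_const * c,
    T x0 -> delta x0 < eps / 4 -> `|jac G x0 - 1%:M| <= jac_const * delta x0 &
    ~ Theta x0 -> C1at G x0].
  move=> /C1at_identity_near[CG JE]; split=> //.
  - exact: (nbhs_singleton CG.1).
  - by rewrite JE; apply: z; exact: ltW.
  - by move=> _ _; rewrite JE; apply: z; exact: enorm_ge0.
have [Tx0|nTx0] := pselect (T x0); last first.
  apply: idcase; have k0 : 0 < eps - c by move: eps0 ceps; lra.
  apply: (enorm_nbhs k0) => x xk.
  have [Tx|/Gout//] := pselect (T x); apply: G_far => //.
  rewrite leNgt; apply/negP => xc; apply: nTx0; apply: (tube_ball proj Tx).
  by rewrite (enormB x0); lra.
have [d0|d0] := eqVneq (delta x0) 0.
  have Tx := tube_dist0 proj Tx0 d0.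
  have t1 := G_on_Theta Tx; rewrite (tder_jac t1).
  by split=> //; [apply: z; exact: ltW|move=> _ _; apply: z; exact: enorm_ge0].
have dpos : 0 < delta x0 by rewrite lt_def d0 enorm_ge0.
have [d4|/negP] := pselect (is_true (delta x0 < eps / 4)).
  have [CG /nbhs_singleton[j1 j2]] := G_off_Theta Tx0 dpos d4.
  by split=> //; exact: (nbhs_singleton CG.1).
rewrite -leNgt => d4; apply: idcase; have k0 : 0 < delta x0 - c by move: ceps; lra.
apply: filterS2 (tube_near proj Tx0) (near_enorm x0 k0) => x Tx xk; apply: G_far => //.
by have := tube_dist_lip proj Tx Tx0; rewrite (enormB x0 x); lra.
Qed.

(** At a point [x0] of [Theta] the Jacobian differs from the identity by at most
    [jac_const * delta x], and [delta x <= enorm (x - x0)]; this gives its continuity. *)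
Lemma G_C1at x0 : C1at G x0.
Proof.
have [eps0 _ pmin _] := proj.
have [Tx0|nTx0] := pselect (Theta x0); last by case: (G_jac x0) => _ _ _; exact.
split; first by apply: (enorm_nbhs ltr01) => x _; case: (G_jac x).
have tx0 := sub_tube proj Tx0.
have J0 := tder_jac (G_on_Theta Tx0).
apply: (@near_lip_continuous _ _ _ _ _ (jac_const * d%:R)); first by rewrite mulr_ge0.
have k0 : 0 < eps / 4 by rewrite divr_gt0.
apply: filterS2 (tube_near proj tx0) (near_enorm x0 k0) => x Tx xk.
have dx : delta x <= enorm (x - x0) by exact: pmin.
rewrite J0; have [_ _ h _] := G_jac x.
apply: le_trans (h Tx (le_lt_trans dx xk)) _; rewrite -mulrA ler_wpM2l//.
exact: le_trans dx (enorm_le_mx_norm _).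
Qed.

End Transformation.

(** * Global inversion of small perturbations of the identity *)

Section NearIdentity.
Context {R : realType} {d : nat}.
Local Notation V := 'rV[R]_d.

(* Edelstein: a minimiser of [|f x - x|] over an invariant ball is a fixed point. *)
Lemma half_lip_fixpoint (f : V -> V) : (forall x y, `|f x - f y| <= 2^-1 * `|x - y|) ->
  exists x, f x = x.
Proof.
move=> fl; pose A := [set x : V | `|x| <= 2 * `|f 0|].
have fA x : A x -> A (f x).
  rewrite /A /= => Ax; have := fl x 0; rewrite subr0 => fx.
  have := ler_normD (f x - f 0) (f 0); rewrite subrK; lra.
have cA : compact A.
  apply: bounded_closed_compact.
    exists (2 * `|f 0|); split; first exact: num_real.
    by move=> M hM x /= /le_trans; apply; exact: ltW.
  apply: (@closed_comp _ _ (fun x : V => `|x|) [set t | t <= 2 * `|f 0|]); last exact: closed_le.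
  move=> x _; apply: (@lip_continuous _ _ _ (fun x : V => `|x|) 1) => // y z.
  by rewrite mul1r ler_dist_dist.
have A0 : A !=set0 by exists 0; rewrite /A /= normr0 mulr_ge0.
have [|x] := compact_EVT_min A0 cA (f := fun x => `|f x - x|).
  apply: continuous_subspaceT; apply: (@lip_continuous _ _ _ (fun x => `|f x - x|) 2) => // x y.
  apply: le_trans (ler_dist_dist _ _) _.
  have -> : f y - y - (f x - x) = (f y - f x) - (y - x) by vec.
  apply: le_trans (ler_normB _ _) _; have := fl y x; have := normr_ge0 (y - x); lra.
rewrite inE => Ax xmin; exists x; apply/eqP; rewrite -subr_eq0 -normr_le0.
have := xmin (f x); rewrite inE => /(_ (fA _ Ax)); have := fl (f x) x; lra.
Qed.

(** [G - Id] is 1/2-Lipschitz, so [G] shrinks distances by at most a factor 2, hence is injective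
    with a 2-Lipschitz inverse; a preimage of [z] is a fixed point of [x] sent to
    [z - (G x - x)]. *)
Lemma near_identity_diffeomorphism (G : V -> V) : (forall x, C1at G x) ->
  (forall x (u : V), `|u *m (jac G x - 1%:M)| <= 2^-1 * `|u|) -> diffeomorphism G.
Proof.
move=> CG JG.
have tG x : tder G x (fun u => u *m jac G x) by exact: (nbhs_singleton (CG x).1).
have gl x y : `|(G y - y) - (G x - x)| <= 2^-1 * `|y - x|.
  apply: (@mean_value_ineq _ _ _ (fun x => G x - x) (fun x => jac G x - 1%:M)) => // {}x e e0.
  apply: filterS (tG x e e0) => {}y; rewrite mulmxBr mulmx1; congr (`| _ | <= _).
  by move: (_ *m _) => w; vec.
have expand x y : `|y - x| <= 2 * `|G y - G x|.
  have E : y - x = (G y - G x) - ((G y - y) - (G x - x)) by vec.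
  have : `|y - x| <= `|G y - G x| + 2^-1 * `|y - x|.
    rewrite {1}E; apply: le_trans (ler_normB _ _) _; by rewrite lerD2l.
  lra.
have surj z : exists x, G x = z.
  have [x fx] := @half_lip_fixpoint (fun x => z - (G x - x)) (fun x y => ltac:(
    rewrite (_ : z - (G x - x) - (z - (G y - y)) = (G y - y) - (G x - x)); [rewrite (distrC x); exact: gl|by vec])).
  exists x; move/eqP: fx; rewrite subr_eq => /eqP ->.
  by vec.
pose H z := xget 0 [set x | G x = z].
have HK z : G (H z) = z.
  by have [x Gx] := surj z; exact: (@xgetPex _ 0 [set x | G x = z] (ex_intro _ x Gx)).
have GK x : H (G x) = x.
  apply/eqP; rewrite -subr_eq0 -normr_le0; apply: le_trans (expand _ _) _.
  by rewrite HK subrr normr0 mulr0.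
have Hl z z' : `|H z' - H z| <= 2 * `|z' - z|.
  by have := expand (H z) (H z'); rewrite !HK.
have Hc : continuous H by apply: (@lip_continuous _ _ _ H 2).
exists H; split=> //; first exact: C1at_Ck_on.
apply: C1at_Ck_on => z0.
(* The inverse [H] satisfies [(H z' - H z) *m jac G (H z) = z' - z] up to little-o, which is the
   relation of [implicit_C1at] with [N] the identity. *)
have [] // := @implicit_C1at _ _ H (fun z => jac G (H z)) (fun=> 1%:M) z0 2.
- by apply: (enorm_nbhs ltr01) => z _; apply: (enorm_nbhs ltr01) => z' _; exact: Hl.
- apply: (@continuous_comp _ _ _ H (jac G)); [exact: Hc|exact: (CG _).2].
- exact: cst_continuous.
- apply: (enorm_nbhs ltr01) => z _; apply: unitmx_inj => v vJ.
  have := JG (H z) v; rewrite mulmxBr vJ mulmx1 sub0r normrN => h.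
  by apply/eqP; rewrite -normr_le0; have := normr_ge0 v; lra.
apply: (enorm_nbhs ltr01) => z _ e e0.
have e2 : 0 < e / 2 by rewrite divr_gt0.
have hz : \forall z' \near z, `|G (H z') - G (H z) - (H z' - H z) *m jac G (H z)| <= e / 2 * `|H z' - H z|.
  exact: (Hc z _ (tG (H z) _ e2)).
apply: filterS hz => z'; rewrite !HK mulmx1 => h.
rewrite distrC; apply: le_trans h _.
have : e / 2 * `|H z' - H z| <= e / 2 * (2 * `|z' - z|) by rewrite ler_pM2l.
by rewrite mulrA divfK.
Qed.

End NearIdentity.

Lemma dist_set_ltP {R : realType} {d : nat} (A : set 'rV[R]_d) (x : 'rV[R]_d) (e : R) :
  (dist_set x A < e%:E)%E <-> tube A e x.
Proof.
split=> [/ereal_inf_lt[_ [xi Axi <-]]|[xi Axi xe]]; first by rewrite lte_fin; exists xi.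
apply: (@le_lt_trans _ _ (enorm (x - xi))%:E); last by rewrite lte_fin.
by apply: ereal_inf_lbound; exists xi.
Qed.

Lemma dist_set_le {R : realType} {d : nat} (A : set 'rV[R]_d) (x xi : 'rV[R]_d) :
  A xi -> (dist_set x A <= (enorm (x - xi))%:E)%E.
Proof. by move=> Axi; apply: ereal_inf_lbound; exists xi. Qed.

Lemma closest_point_projection {R : realType} {d : nat} (Theta : set 'rV[R]_d) (eps : R)
    (p : 'rV[R]_d -> 'rV[R]_d) : 0 < eps ->
  (forall x, (dist_set x Theta < eps%:E)%E -> exists! xi, closest_point Theta x xi) ->
  (forall x, (dist_set x Theta < eps%:E)%E -> closest_point Theta x (p x)) ->
  nearest_projection Theta eps p.
Proof.
move=> eps0 uniq clp; split=> // [x /dist_set_ltP/clp[]//|x xi /dist_set_ltP/clp[_ px] Txi|x xi].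
  by rewrite -lee_fin px dist_set_le.
move=> /dist_set_ltP Tx Txi le_xi; have [y [_ yuniq]] := uniq x Tx.
have cp := clp x Tx; rewrite -(yuniq _ cp); apply/esym/yuniq; split=> //.
by apply/eqP; rewrite eq_le dist_set_le// andbT -cp.2 lee_fin.
Qed.

Theorem theorem3p18 (R : realType) (d : nat)
    (mu : 'rV[R]_d -> 'rV[R]_d) (sigma : 'rV[R]_d -> 'M[R]_d)
    (Theta : set 'rV[R]_d) (eps0 c0 a : R) (p : 'rV[R]_d -> 'rV[R]_d) :
  borel_measurable mu -> borel_measurable sigma ->
  (* (A1) *)
  piecewise_lipschitz_wrt mu Theta -> hypersurface 3 Theta ->
  (* (A2) *)
  0 < eps0 ->
  (forall x, (dist_set x Theta < eps0%:E)%E ->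
     exists! xi, closest_point Theta x xi) ->
  (* p is the closest-point map on Theta^eps0 *)
  (forall x, (dist_set x Theta < eps0%:E)%E -> closest_point Theta x (p x)) ->
  (* (A3) *)
  0 < c0 ->
  (forall xi v, Theta xi -> unit_normal Theta xi v ->
     c0 <= enorm (v *m (sigma xi))) ->
  (* (A4) *)
  alpha_regular mu sigma Theta a ->
  exists c1 : R, 0 < c1 /\
    forall c : R, 0 < c -> c < c1 -> c < eps0 ->
    forall G : 'rV[R]_d -> 'rV[R]_d,
      G_spec mu sigma Theta p eps0 c G -> diffeomorphism G.
Proof.
move=> _ _ _ hyp eps00 uniq clp _ _ areg.
have proj := closest_point_projection eps00 uniq clp.
(* The extra [d] turns the entrywise bound on [jac G x - 1%:M] into an operator bound in the sup
   norm. *)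
pose C : R := d%:R * @jac_const R d a.
have C0 : 0 <= C by rewrite !(mulr_ge0, addr_ge0, exprn_ge0).
(* [1] and [eps0 / 4] are the conditions under which the Jacobian bounds hold; the last entry gives
   [C * c <= 1 / 2], with [C + 1] guarding against [C = 0]. *)
exists (Num.min 1 (Num.min (eps0 / 4) ((2 * (C + 1))^-1))); split.
  by rewrite !lt_min ltr01 divr_gt0// invr_gt0 mulr_gt0// ltr_wpDl.
move=> c cpos; rewrite !lt_min => /and3P[c1 c4 cC] _ G Gspec.
have Gtube x v : tube Theta eps0 x -> unit_normal Theta (p x) v ->
    G x = x + phitilde p c v x *: alpha_at mu sigma (p x) v.
  by move=> /dist_set_ltP Tx; exact: (Gspec x).1.
have Gout x : ~ tube Theta eps0 x -> G x = x.
  by move=> nTx; apply: (Gspec x).2 => /dist_set_ltP.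
apply: near_identity_diffeomorphism => [x|x u].
  exact: (G_C1at proj hyp areg cpos (ltW c1) c4 Gtube Gout).
have [_ Jc _ _] := G_jac proj hyp areg cpos (ltW c1) c4 Gtube Gout x.
apply: le_trans (norm_mulmx_rV _ _) _; rewrite ler_wpM2r//.
apply: (@le_trans _ _ (C * c)); first by rewrite /C -mulrA ler_wpM2l.
have C1 : 0 < C + 1 by rewrite ltr_wpDl.
move: cC; rewrite -[X in c < X]div1r ltr_pdivlMr ?mulr_gt0// => cC; lra.
Qed.
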